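(* Let $(a_n)_{n\geq1}$ be a sequence of integers such that for some $t \in \mathbb{N}$ we have $|a_n| \leq n^t$ for all sufficiently large $n$. Assume there exist $\tau \in (0,1)$, reals $1 < B' < B$, and a strictly increasing sequence $(B_L)_{L\geq1}$ of positive integers with $(B')^L \leq B_L \leq B^L$ for all $L$, such that for every $\varepsilon > 0$ there is $L(\varepsilon)$ with $$\int_0^1 \left| \sum_{n=1}^{B_L} e^{2\pi i a_n \alpha} \right| d\alpha > B_L^{\tau - \varepsilon} \qquad \text{for all } L > L(\varepsilon).$$ Then for almost all $\alpha \in [0,1)$ the discrepancy $D_N$ of $(\{a_n\alpha\})_{n\geq1}$ satisfies: for every $\varepsilon>0$ there are infinitely many $N$ with $N D_N > N^{\tau - \varepsilon}$.
   Context: For real $x$, $\{x\}$ denotes the fractional part of $x$. For a sequence $(x_n)_{n\ge1}$ in $[0,1)$, its discrepancy is $$D_N = \sup_{0 \leq a < b \leq 1} \left| \frac{A_N([a,b))}{N} - (b-a) \right|, \qquad A_N([a,b)) = \#\{1 \leq n \leq N : x_n \in [a,b)\}.$$ *)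

(* Defs.v *)
From Stdlib Require Import Reals Lra Lia.
Open Scope R_scope.

Fixpoint ssum (f : nat -> R) (M : nat) : R :=
  match M with
  | O => 0
  | S m => ssum f m + f (S m)
  end.

Fixpoint count_in (x : nat -> R) (a b : R) (N : nat) : nat :=
  match N with
  | O => O
  | S m => (count_in x a b m +
            (if Rle_dec a (x (S m)) then
               (if Rlt_dec (x (S m)) b then 1 else 0) else 0))%nat
  end.

Lemma count_in_le x a b N : (count_in x a b N <= N)%nat.
Proof.
  induction N as [|m IH]; simpl; [lia|].
  destruct (Rle_dec a (x (S m))); [destruct (Rlt_dec (x (S m)) b)|]; lia.
Qed.

Definition disc_set (x : nat -> R) (N : nat) (y : R) : Prop :=
  exists a b, 0 <= a /\ a < b /\ b <= 1 /\
    y = Rabs (INR (count_in x a b N) / INR N - (b - a)).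

Lemma disc_set_bound x N : bound (disc_set x N).
Proof.
  exists 2. intros y [a [b [Ha [Hab [Hb ->]]]]].
  assert (Hc : 0 <= INR (count_in x a b N) / INR N <= 1).
  { destruct N as [|N].
    - assert (count_in x a b 0 = 0%nat) as -> by reflexivity.
      simpl. unfold Rdiv. rewrite Rmult_0_l. lra.
    - pose proof (count_in_le x a b (S N)) as Hle.
      apply le_INR in Hle. pose proof (pos_INR (count_in x a b (S N))).
      assert (0 < INR (S N)) by (apply lt_0_INR; lia).
      split.
      + apply Rmult_le_pos; [lra|]. left. apply Rinv_0_lt_compat. lra.
      + apply Rmult_le_reg_r with (INR (S N)); [lra|].
        unfold Rdiv. rewrite Rmult_assoc, Rinv_l by lra. lra. }
  unfold Rabs. destruct (Rcase_abs _); lra.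
Qed.

Lemma disc_set_ne x N : exists y, disc_set x N y.
Proof.
  exists (Rabs (INR (count_in x 0 1 N) / INR N - (1 - 0))).
  exists 0, 1. repeat split; try lra; reflexivity.
Qed.

Definition discrepancy (x : nat -> R) (N : nat) : R :=
  proj1_sig (completeness (disc_set x N) (disc_set_bound x N) (disc_set_ne x N)).

Definition null_set (S : R -> Prop) : Prop :=
  forall eps, 0 < eps ->
    exists c d : nat -> R,
      (forall k, c k <= d k) /\
      (forall n, sum_f_R0 (fun k => d k - c k) n <= eps) /\
      (forall y, S y -> exists k, c k < y < d k).

(* | sum_{n=1}^{M} e^{2 pi i a_n alpha} | *)
Definition exp_sum_abs (a : nat -> Z) (M : nat) (alpha : R) : R :=
  sqrt ((ssum (fun n => cos (2 * PI * IZR (a n) * alpha)) M) ^ 2 +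
        (ssum (fun n => sin (2 * PI * IZR (a n) * alpha)) M) ^ 2).

(* Main.v *)
Require Import Defs.
From Stdlib Require Import ZArith Reals Lra Lia List IndefiniteDescription Classical.
From mathcomp Require all_boot all_order all_algebra ring zify complex Rstruct.
From Coquelicot Require Coquelicot.
Open Scope R_scope.

(** Write N = B_L and f(x) = |sum_(n <= N) e(a_n x)|. By Koksma's inequality
    f(h alpha) <= 2 pi h N D_N(alpha) for every h >= 1, so it suffices to find, for
    most alpha, an h with f(h alpha) / h large. As the mean of f exceeds
    N^(tau - e), some dyadic level V satisfies V * |{f >= V}| >= N^(tau - 2e).
    Let G be a Lipschitz cut-off of {f >= V}, of mean m, and let H be about
    N^(2e) / m. The variance of sum_(h <= H) G(h alpha) is at most H m times the
    largest number of divisors of an integer below a power of N, hence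
    H m N^e, because the Fourier coefficients of G beyond a power of N are
    negligible. By Chebyshev, outside a set of measure O(N^(-e)) some h <= H has
    G(h alpha) > 0, and then f(h alpha) / h >= V / (2 H) >= N^(tau - O(e)).

    Everything is done on the grid (1/Q)Z with Q a power of N: the functions
    involved are Lipschitz with a constant polynomial in N, so integrals become
    averages over Z/Q, Fourier series become discrete Fourier transforms, and the
    exceptional set is covered by finitely many grid cells. *)

(** * The divisor bound *)

Module Divisors.
Import all_boot.
Set Implicit Arguments.
Unset Strict Implicit.
Local Open Scope nat_scope.

(** A divisor d of ab is recovered from the pair (g, d / g) with g = gcd(d, a). The cofactor d / g
    is coprime to a / g and divides (a / g) b, hence it divides b. *)
Lemma size_divisorsM a b : 0 < a -> 0 < b ->
  size (divisors (a * b)) <= size (divisors a) * size (divisors b).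
Proof.
move=> a0 b0; have ab0 : 0 < a * b by rewrite muln_gt0 a0.
rewrite -(size_allpairs muln).
apply: uniq_leq_size (divisors_uniq _) _ => d.
rewrite -dvdn_divisors // => dab.
have d0 : 0 < d by apply: dvdn_gt0 dab.
have g0 : 0 < gcdn d a by rewrite gcdn_gt0 d0.
apply/allpairsP; exists (gcdn d a, d %/ gcdn d a); split => /=.
- by rewrite -dvdn_divisors // dvdn_gcdr.
- rewrite -dvdn_divisors // -(@Gauss_dvdr _ (a %/ gcdn d a)).
    rewrite -(dvdn_pmul2l g0) [in X in X %| _]mulnC divnK ?dvdn_gcdl //.
    by rewrite mulnA [gcdn d a * _]mulnC divnK // dvdn_gcdr.
  by rewrite /coprime -(eqn_pmul2l g0) muln_gcdr muln1 ![gcdn d a * (_ %/ _)]mulnC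
    !divnK ?dvdn_gcdl ?dvdn_gcdr.
- by rewrite mulnC divnK // dvdn_gcdl.
Qed.

Lemma size_divisors_pfactor p e : prime p -> size (divisors (p ^ e)) <= e.+1.
Proof.
move=> p_pr; rewrite -[leqRHS](size_iota 0) -(size_map (expn p) (iota 0 e.+1)).
apply: uniq_leq_size (divisors_uniq _) _ => d.
rewrite -dvdn_divisors ?expn_gt0 ?prime_gt0 // => /dvdn_pfactor [] // i ie ->.
by apply: map_f; rewrite mem_iota add0n ltnS.
Qed.

(** With k the integer part of e / s, e + 1 <= s (k + 1) <= s 2^k; raise this to the power s. It
    pays for the e + 1 divisors of a prime power p^e by p^e itself, up to the constant s^s. *)
Lemma expn_succ_le s e : 0 < s -> e.+1 ^ s <= s ^ s * 2 ^ e.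
Proof.
move=> s0; apply: (@leq_trans ((s * 2 ^ (e %/ s)) ^ s)).
  rewrite leq_exp2r //; apply: (@leq_trans (s * (e %/ s).+1)).
    by rewrite mulnC ltn_ceil.
  by rewrite leq_mul2l ltn_expl ?orbT.
by rewrite expnMn -expnM leq_mul2l leq_exp2l // leq_trunc_div orbT.
Qed.

(** Removing one prime p from n at most halves the number of divisors, so the s-th power drops by a
    factor of at most 2^s <= p. *)
Lemma divisor_bound_rough s n : 0 < s -> 0 < n ->
  (forall p, prime p -> p %| n -> 2 ^ s <= p) -> size (divisors n) ^ s <= n.
Proof.
move=> s0; elim/ltn_ind: n => n IH n0 rough.
case: (leqP n 1) => [n1|n1].
  have -> : n = 1 by apply/eqP; rewrite eqn_leq n1.
  by rewrite exp1n.
have p_pr := pdiv_prime n1; set p := pdiv n in p_pr *.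
have pn : p %| n by apply: pdiv_dvd.
have p0 := prime_gt0 p_pr.
have nE : n = p * (n %/ p) by rewrite mulnC divnK.
have m0 : 0 < n %/ p by rewrite divn_gt0 // dvdn_leq.
have ltm : n %/ p < n by rewrite ltn_Pdiv ?prime_gt1.
have IHm : size (divisors (n %/ p)) ^ s <= n %/ p.
  apply: IH => // q q_pr qm; apply: rough => //.
  by rewrite nE dvdn_mull.
apply: (@leq_trans ((2 * size (divisors (n %/ p))) ^ s)).
  rewrite leq_exp2r // {1}nE; apply: leq_trans (size_divisorsM p0 m0) _.
  by have := size_divisors_pfactor 1 p_pr; rewrite expn1 leq_mul2r => ->; rewrite orbT.
by rewrite expnMn [leqRHS]nE leq_mul // rough.
Qed.

(** This is d(n) = O(n^(1/s)) in integer form. The induction on i lowers the least admissible prime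
    factor from 2^s to 2^s - i. At each step the only new prime is q = 2^s - (i + 1): its full power
    is split off at the cost of s^s, and if q is composite the previous case applies. At i = 2^s no
    restriction is left. *)
Theorem divisor_bound s : 0 < s ->
  exists C, forall n, 0 < n -> size (divisors n) ^ s <= C * n.
Proof.
move=> s0.
suff H i : exists C, forall n, 0 < n ->
    (forall p, prime p -> p %| n -> 2 ^ s - i <= p) ->
    size (divisors n) ^ s <= C * n.
  have [C HC] := H (2 ^ s); exists C => n n0; apply: HC => // p _ _.
  by rewrite subnn.
elim: i => [|i [C HC]].
  exists 1 => n n0 rough; rewrite mul1n divisor_bound_rough // => p p_pr pn.
  by rewrite -[2 ^ s]subn0 rough.
set q := 2 ^ s - i.+1; exists (s ^ s * C) => n n0 rough.
have q1 : 2 ^ s - i <= q.+1 by rewrite /q subnS leqSpred.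
case: (boolP (prime q)) => [q_pr|q_npr]; last first.
  apply: leq_trans (HC n n0 _) _; last first.
    by rewrite leq_mul2r -[leqLHS]mul1n leq_mul2r expn_gt0 s0 !orbT.
  move=> p p_pr pn; apply: leq_trans q1 _; rewrite ltn_neqAle rough // andbT.
  by apply: contraNneq q_npr => ->.
have [m mNq nE] := pfactor_coprime q_pr n0; set e := logn q n in nE.
have m0 : 0 < m by move: n0; rewrite nE muln_gt0 => /andP[].
have qe0 : 0 < q ^ e by rewrite expn_gt0 prime_gt0.
have Hm : size (divisors m) ^ s <= C * m.
  apply: HC => // p p_pr pm; apply: leq_trans q1 _.
  rewrite ltn_neqAle rough ?andbT //; last by rewrite nE dvdn_mulr.
  by apply: contraTneq pm => <-; rewrite -prime_coprime.
apply: (@leq_trans ((size (divisors m) * e.+1) ^ s)).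
  rewrite leq_exp2r // nE; apply: leq_trans (size_divisorsM m0 qe0) _.
  by rewrite leq_mul2l size_divisors_pfactor ?orbT.
rewrite expnMn [in leqRHS]nE mulnC -mulnA [C * _]mulnA mulnCA [leqRHS]mulnCA.
rewrite [leqRHS]mulnC -mulnA [leqLHS]mulnC.
apply: leq_mul => //; apply: leq_trans (expn_succ_le e s0) _.
rewrite mulnC leq_mul2r; case: e {nE qe0} => [|e]; first by rewrite !expn0 orbT.
by rewrite leq_exp2r // prime_gt1 // orbT.
Qed.
End Divisors.

(** * Finite Fourier analysis *)

Module Fourier.
Import all_boot all_order all_algebra ring zify.
Set Implicit Arguments.
Unset Strict Implicit.
Import Order.TTheory GRing.Theory Num.Theory.
Local Open Scope ring_scope.

Lemma sum_ordS (V : zmodType) Q (G : nat -> V) : G Q = G 0%N ->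
  \sum_(x < Q) G x.+1 = \sum_(x < Q) G x.
Proof.
case: Q => [|Q] GQ; first by rewrite !big_ord0.
by rewrite big_ord_recr [RHS]big_ord_recl /= GQ addrC.
Qed.

Section Fourier.
Context (C : numClosedFieldType).
Implicit Types (z : C) (Q K H r : nat) (G : nat -> C).

Lemma norm_prim_rootX Q z k : Q.-primitive_root z -> `|z ^+ k| = 1.
Proof.
move=> zP; have Q0 := prim_order_gt0 zP.
suff z1 : `|z| = 1 by rewrite normrX z1 expr1n.
by apply/eqP; rewrite -(@pexpr_eq1 _ _ Q) // -normrX (prim_expr_order zP) normr1.
Qed.

Lemma prim_rootX_mulJ Q z k : Q.-primitive_root z -> z ^+ k * (z ^+ k)^* = 1.
Proof. by move=> zP; rewrite -normCK (norm_prim_rootX _ zP) expr1n. Qed.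

Lemma conj_prim_root Q z : Q.-primitive_root z -> Q.-primitive_root z^*.
Proof. by move=> zP; rewrite fmorph_primitive_root. Qed.

Lemma prim_root_ortho Q z a b : Q.-primitive_root z ->
  \sum_(x < Q) z ^+ (a * x) * (z ^+ (b * x))^* =
  if a == b %[mod Q] then Q%:R else 0.
Proof.
move=> zP; set u := z ^+ a * (z ^+ b)^*.
have uE (x : 'I_Q) : z ^+ (a * x) * (z ^+ (b * x))^* = u ^+ x.
  by rewrite !exprM rmorphXn /= -exprMn.
rewrite (eq_bigr _ (fun x _ => uE x)) -(eq_prim_root_expr zP).
have uQ : u ^+ Q = 1.
  by rewrite exprMn -rmorphXn -!exprM mulnC [(b * _)%N]mulnC !exprM
    (prim_expr_order zP) !expr1n rmorph1 mulr1.
have [zab|zab] := eqVneq.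
  rewrite /u zab (prim_rootX_mulJ _ zP).
  by rewrite (eq_bigr (fun=> 1)) ?sumr_const ?card_ord // => x _; rewrite expr1n.
have u1 : u - 1 != 0.
  apply: contra zab; rewrite subr_eq0 => /eqP u1.
  have := congr1 ( *%R^~ (z ^+ b)) u1.
  by rewrite /u -mulrA [_^* * _]mulrC (prim_rootX_mulJ _ zP) mulr1 mul1r => ->.
by apply: (mulfI u1); rewrite -subrX1 uQ subrr mulr0.
Qed.

(** Use w p w q <= (w p ^ 2 + w q ^ 2) / 2. By symmetry of E both halves have the same sum, in which
    each w p ^ 2 occurs at most r times. *)
Lemma sum_mul_le_fiber (P : finType) (D : pred P) (E : rel P) (w : P -> C) r :
  symmetric E -> (forall p, 0 <= w p) ->
  (forall p, D p -> (#|[pred q | D q && E p q]| <= r)%N) ->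
  \sum_(p | D p) \sum_(q | D q && E p q) w p * w q <=
  r%:R * \sum_(p | D p) w p ^+ 2.
Proof.
move=> Esym w0 card_le.
have half p q : w p * w q <= w p ^+ 2 / 2%:R + w q ^+ 2 / 2%:R.
  by rewrite -mulrDl; apply: real_leif_mean_square; apply: ger0_real.
apply: (@le_trans _ _ (\sum_(p | D p) \sum_(q | D q && E p q) w p ^+ 2)).
  apply: (@le_trans _ _ (\sum_(p | D p) \sum_(q | D q && E p q)
    (w p ^+ 2 / 2%:R + w q ^+ 2 / 2%:R))).
    by do 2![apply: ler_sum => ? _].
  under eq_bigr do rewrite big_split /=.
  rewrite big_split /= [X in _ + X](exchange_big_dep D) /=; last first.
    by move=> p q _ /andP[].
  rewrite -big_split /=; apply: ler_sum => p Dp.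
  rewrite [X in _ + X](eq_bigl (fun q => D q && E p q)); last first.
    by move=> q; rewrite Dp /= Esym.
  rewrite -big_split /=; apply: ler_sum => q _.
  by rewrite -splitr.
rewrite mulr_sumr; apply: ler_sum => p Dp.
rewrite sumr_const -[leLHS]mulr_natl ler_wpM2r ?exprn_ge0 // ler_nat.
exact: card_le.
Qed.

(* Expanding the square leaves only the pairs of equal frequencies, of which
   each term meets at most r. *)
Lemma exp_sum_sqr_le Q z (P : finType) (D : pred P) (w : P -> C)
    (nu : P -> nat) r : Q.-primitive_root z ->
  (forall p, D p -> (#|[pred q | D q && (nu p == nu q %[mod Q])]| <= r)%N) ->
  \sum_(x < Q) `|\sum_(p | D p) w p * z ^+ (nu p * x)| ^+ 2 <=
  Q%:R * (r%:R * \sum_(p | D p) `|w p| ^+ 2).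
Proof.
move=> zP card_le.
rewrite -[leLHS]ger0_norm; last by apply: sumr_ge0 => x _; rewrite exprn_ge0.
have -> : \sum_(x < Q) `|\sum_(p | D p) w p * z ^+ (nu p * x)| ^+ 2 =
    Q%:R * \sum_(p | D p) \sum_(q | D q && (nu p == nu q %[mod Q]))
      w p * (w q)^*.
  transitivity (\sum_(p | D p) \sum_(q | D q) w p * (w q)^* *
      \sum_(x < Q) z ^+ (nu p * x) * (z ^+ (nu q * x))^*).
    under eq_bigr do rewrite normCK rmorph_sum /= mulr_suml.
    rewrite exchange_big; apply: eq_bigr => p _ /=.
    under eq_bigr do rewrite mulr_sumr.
    rewrite exchange_big; apply: eq_bigr => q _ /=.
    rewrite mulr_sumr; apply: eq_bigr => x _.
    by rewrite rmorphM /= mulrACA.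
  rewrite mulr_sumr; apply: eq_bigr => p _.
  rewrite mulr_sumr big_mkcondr /=; apply: eq_bigr => q _.
  rewrite (prim_root_ortho _ _ zP); case: ifP => _; last by rewrite mulr0.
  by rewrite mulrC.
rewrite normrM normr_nat ler_wpM2l ?ler0n //.
apply: le_trans (ler_norm_sum _ _ _) _.
have Esym : symmetric (fun p q => nu p == nu q %[mod Q]).
  by move=> p q; rewrite eq_sym.
apply: le_trans (sum_mul_le_fiber Esym (fun p => normr_ge0 (w p)) card_le).
apply: ler_sum => p _; apply: le_trans (ler_norm_sum _ _ _) _.
by apply: ler_sum => q _; rewrite normrM norm_conjC.
Qed.

(** Cauchy-Schwarz, as the instance of [sum_mul_le_fiber] in which all pairs are related. *)
Lemma sqr_sum_le (P : finType) (D : pred P) (w : P -> C) :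
  (forall p, 0 <= w p) ->
  (\sum_(p | D p) w p) ^+ 2 <= #|P|%:R * \sum_(p | D p) w p ^+ 2.
Proof.
move=> w0; have Esym : symmetric (fun p q : P => true) by [].
rewrite expr2 mulr_suml.
apply: le_trans (sum_mul_le_fiber Esym w0 (r := #|P|) _); last first.
  by move=> p _; apply: max_card.
rewrite le_eqVlt; apply/orP; left; apply/eqP; apply: eq_bigr => p _.
by rewrite mulr_sumr; apply: eq_bigl => q; rewrite andbT.
Qed.

Lemma sqr_normD_le (x y : C) : `|x + y| ^+ 2 <= 2%:R * `|x| ^+ 2 + 2%:R * `|y| ^+ 2.
Proof.
have H : `|x + y| ^+ 2 <= (`|x| + `|y|) ^+ 2.
  by rewrite lerXn2r ?nnegrE ?addr_ge0 ?ler_normD.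
apply: le_trans H _; rewrite sqrrD.
rewrite -subr_ge0.
have -> : 2%:R * `|x| ^+ 2 + 2%:R * `|y| ^+ 2 -
  (`|x| ^+ 2 + `|x| * `|y| *+ 2 + `|y| ^+ 2) = (`|x| - `|y|) ^+ 2 by ring.
by rewrite real_exprn_even_ge0 // realB // normr_real.
Qed.

(** The factor 1/Q is put here, so that coefficient 0 is the mean of G and the inversion formula
    carries no factor. *)
Definition dft Q z G (k : nat) : C :=
  Q%:R^-1 * \sum_(x < Q) G x * (z ^+ (k * x))^*.

Lemma prim_order_natr_neq0 Q z : Q.-primitive_root z -> Q%:R != 0 :> C.
Proof. by move=> zP; rewrite pnatr_eq0 -lt0n (prim_order_gt0 zP). Qed.

Lemma dft_inversion Q z G x : Q.-primitive_root z ->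
  (forall y, G (y %% Q)%N = G y) ->
  \sum_(k < Q) dft Q z G k * z ^+ (k * x) = G x.
Proof.
move=> zP Gper; have Q0 := prim_order_gt0 zP.
transitivity (Q%:R^-1 * \sum_(y < Q) G y *
    \sum_(k < Q) z ^+ (x * k) * (z ^+ (y * k))^*).
  rewrite mulr_sumr.
  under [RHS]eq_bigr do rewrite mulr_sumr mulr_sumr.
  rewrite exchange_big; apply: eq_bigr => k _ /=.
  rewrite /dft -mulrA mulr_suml mulr_sumr; apply: eq_bigr => y _.
  by rewrite -mulrA [in RHS]mulrC [(k * y)%N]mulnC [(k * x)%N]mulnC [in RHS]mulrC
    [_^* * _]mulrC.
under eq_bigr do rewrite (prim_root_ortho _ _ zP).
rewrite (bigD1 (Ordinal (ltn_pmod x Q0))) //= big1 => [|y ynx]; last first.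
  rewrite ifN ?mulr0 //; apply: contra ynx => /eqP xy.
  by apply/eqP/val_inj; rewrite /= xy modn_small.
rewrite modn_mod eqxx addr0 Gper [G x * _]mulrC mulrA.
by rewrite mulVf ?mul1r // (prim_order_natr_neq0 zP).
Qed.

(** [exp_sum_sqr_le] for the conjugate root with the roles of x and k exchanged: the frequencies x <
    Q are distinct mod Q, so every fibre is a single point. *)
Lemma dft_bessel Q z G : Q.-primitive_root z ->
  Q%:R * \sum_(k < Q) `|dft Q z G k| ^+ 2 <= \sum_(x < Q) `|G x| ^+ 2.
Proof.
move=> zP; have Q0 := prim_order_natr_neq0 zP.
have fib (p : 'I_Q) : true ->
    (#|[pred q : 'I_Q | true && (p == q %[mod Q])]| <= 1)%N.
  move=> _; rewrite -(card1 p); apply/subset_leq_card/subsetP => q.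
  by rewrite !inE /= !modn_small // => /eqP e; apply/eqP/val_inj.
have := exp_sum_sqr_le (fun x : 'I_Q => G x) (conj_prim_root zP) fib.
rewrite mul1r.
rewrite -(@ler_pM2l _ (Q%:R^-1)) ?invr_gt0 ?lt0r ?Q0 ?ler0n //.
rewrite mulrA mulVf // mul1r; apply: le_trans.
rewrite -(@ler_pM2l _ Q%:R) ?lt0r ?Q0 ?ler0n // mulVKf //.
rewrite !mulr_sumr; apply: ler_sum => k _.
rewrite mulrA -expr2 -{1}(normr_nat C Q) -exprMn -normrM /dft mulVKf //.
rewrite (eq_bigr (fun x : 'I_Q => G x * z^* ^+ (x * k))) // => x _.
by rewrite rmorphXn mulnC.
Qed.

Lemma dft_shift Q z G k : Q.-primitive_root z -> G Q = G 0%N ->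
  dft Q z (fun x => G x.+1 - G x) k = dft Q z G k * (z ^+ k - 1).
Proof.
move=> zP GQ; rewrite /dft -mulrA; congr (_ * _).
rewrite mulrBr mulr1.
rewrite -[X in X * _](sum_ordS (G := fun x => G x * (z ^+ (k * x))^*)) /=; last first.
  by rewrite muln0 mulnC exprM (prim_expr_order zP) expr1n GQ.
rewrite mulr_suml -sumrB; apply: eq_bigr => x _.
have -> : G x.+1 * (z ^+ (k * x.+1))^* * z ^+ k = G x.+1 * (z ^+ (k * x))^*.
  rewrite mulnS exprD rmorphM -[RHS]mulr1 -(prim_rootX_mulJ k zP).
  by rewrite /=; ring.
by rewrite mulrBl.
Qed.

(** Bessel's inequality is applied to the difference G (x + 1) - G x. Its k-th coefficient is that
    of G times z^k - 1, a factor of norm at least kap on D. *)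
Lemma dft_tail Q z G (lam kap : C) (D : pred 'I_Q) : Q.-primitive_root z ->
  G Q = G 0%N -> 0 <= lam -> 0 < kap ->
  (forall x, `|G x.+1 - G x| <= lam) ->
  (forall k, D k -> kap <= `|z ^+ k - 1|) ->
  \sum_(k < Q | D k) `|dft Q z G k| ^+ 2 <= (lam / kap) ^+ 2.
Proof.
move=> zP GQ lam0 kap0 Glip Dkap; have Q0 := prim_order_natr_neq0 zP.
have Qgt0 : 0 < Q%:R :> C by rewrite lt0r Q0 ler0n.
have := dft_bessel (fun x => G x.+1 - G x) zP.
move=> /le_trans /(_ (_ : _ <= Q%:R * lam ^+ 2)) => B.
have {B} : Q%:R * \sum_(k < Q) `|dft Q z (fun x => G x.+1 - G x) k| ^+ 2 <=
   Q%:R * lam ^+ 2.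
  apply: B; apply: (@le_trans _ _ (\sum_(x < Q) lam ^+ 2)).
    by apply: ler_sum => x _; rewrite lerXn2r ?nnegrE.
  by rewrite sumr_const card_ord mulr_natl.
rewrite ler_pM2l // => B.
rewrite expr_div_n ler_pdivlMr ?exprn_gt0 // mulr_suml.
apply: le_trans B; rewrite [leLHS]big_mkcond; apply: ler_sum => k _.
case: ifP => [Dk|_]; last by rewrite exprn_ge0.
rewrite (dft_shift _ zP GQ); move: (dft _ _ _ _) => d.
rewrite normrM exprMn ler_wpM2l ?exprn_ge0 //.
by rewrite lerXn2r ?nnegrE ?(ltW kap0) ?Dkap.
Qed.


(** Frequencies are residues in [0, Q), so the negative ones -K, ..., -1 appear as Q - K, ..., Q -
    1. Frequency 0, which carries the mean, is excluded. *)
Definition low_freq Q K (k : nat) := (k != 0%N) && ((k <= K) || (Q <= k + K))%N.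

Lemma low_freq_repr Q K (k : 'I_Q) : low_freq Q K k ->
  exists u s : int, [/\ Posz k = u + s * Posz Q, u != 0 & (`|u| <= K)%N].
Proof.
move=> /andP[k0 /orP[kK|QkK]].
  by exists (Posz k), 0; split; [ring | rewrite eqz_nat |].
have kQ := ltn_ord k.
by exists (Posz k - Posz Q), 1; split; lia.
Qed.

(** Take signed representatives u of size at most K. Products h u have size at most HK < Q / 2, so a
    congruence mod Q between two of them is an equality of integers. Then h divides the fixed
    nonzero number h0 u0, and h determines u, hence k: the fibre injects into the divisors of that
    number. *)
Lemma card_low_fiber Q K H r (h0 : 'I_H) (k0 : 'I_Q) : (2 * H * K < Q)%N ->
  (forall n, (0 < n <= H * K)%N -> (size (divisors n) <= r)%N) ->
  low_freq Q K k0 ->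
  (#|[pred q : 'I_H * 'I_Q | low_freq Q K q.2 &&
        (h0.+1 * k0 == q.1.+1 * q.2 %[mod Q])%N]| <= r)%N.
Proof.
move=> HK divr low0.
have [u0 [s0 [k0E u00 u0K]]] := low_freq_repr low0.
have bnd (h : 'I_H) (u : int) : (`|u| <= K)%N -> `|h.+1%:Z * u| <= Posz (H * K).
  move=> uK; rewrite normrM; have := ltn_ord h; move=> hH.
  have : (h.+1 * `|u| <= H * K)%N by apply: leq_mul.
  by rewrite -lez_nat PoszM abszE.
have small (x y : int) : `|x| <= Posz (H * K) -> `|y| <= Posz (H * K) ->
    (Posz Q %| x - y)%Z -> x = y.
  move=> xHK yHK /dvdzP[v xyE].
  case: (eqVneq v 0) => [v0|v0]; first by move: xyE; rewrite v0; lia.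
  exfalso; have : Posz Q <= `|x - y|.
    rewrite xyE normrM [leRHS]mulrC ler_peMr //; lia.
  lia.
have red (h h' : 'I_H) (k k' : 'I_Q) u s u' s' :
    Posz k = u + s * Posz Q -> Posz k' = u' + s' * Posz Q ->
    (`|u| <= K)%N -> (`|u'| <= K)%N ->
    (h.+1 * k == h'.+1 * k' %[mod Q])%N -> h.+1%:Z * u = h'.+1%:Z * u'.
  move=> kE k'E uK u'K; rewrite -eqz_nat -!modz_nat eqz_mod_dvd => dv.
  apply: small; [exact: bnd | exact: bnd |].
  have -> : h.+1%:Z * u - h'.+1%:Z * u' =
     (Posz (h.+1 * k) - Posz (h'.+1 * k')) +
     (h'.+1%:Z * s' - h.+1%:Z * s) * Posz Q.
    rewrite !PoszM kE k'E; ring.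
  by rewrite rpredD // dvdz_mull.
pose n := (h0.+1 * `|u0|)%N.
have n0 : (0 < n <= H * K)%N.
  by rewrite /n muln_gt0 absz_gt0 u00 leq_mul.
apply: leq_trans (divr n n0).
set A := [pred q | _].
have key (q : 'I_H * 'I_Q) : q \in A -> exists u s : int,
    [/\ Posz q.2 = u + s * Posz Q, (`|u| <= K)%N & h0.+1%:Z * u0 = q.1.+1%:Z * u].
  rewrite inE => /andP[lowq eqq].
  have [u [s [qE _ uK]]] := low_freq_repr lowq.
  by exists u, s; split=> //; apply: red k0E qE u0K uK eqq.
have inj : {in A &, injective (fun q : 'I_H * 'I_Q => q.1.+1)}.
  move=> [h k] [h' k'] /key[u [s [/= kE uK e]]] /key[u' [s' [/= k'E u'K e']]] /= [hh'].
  have hE : h = h' by apply: val_inj.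
  subst h'; congr pair; apply: val_inj => /=.
  have uu' : u = u' by apply: (@mulfI _ h.+1%:Z) => //; rewrite -e -e'.
  subst u'; have := ltn_ord k; have := ltn_ord k' => k'Q kQ.
  case: (ltgtP s s') => ss'; [nia | nia | by move: k'E; rewrite -ss' -kE => -[]].
rewrite -(size_image (fun q : 'I_H * 'I_Q => q.1.+1) A).
apply: uniq_leq_size; first by rewrite map_inj_in_uniq ?enum_uniq // => p q;
  rewrite !mem_enum; apply: inj.
move=> d /imageP[q /key[u [s [_ _ e]]] ->].
rewrite -dvdn_divisors; last by case/andP: n0.
apply/dvdnP; exists `|u|%N; rewrite /n [RHS]mulnC.
by have := congr1 absz e; rewrite !abszM.
Qed.

(** Expand G - m in its Fourier series. Low frequencies give an exponential sum over pairs (h, k)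
    with frequency hk, whose fibres are bounded by the divisor function. High frequencies are
    estimated trivially from [dft_tail]. *)
Theorem dilation_variance Q K H r z G (lam kap m : C) : Q.-primitive_root z ->
  (forall y, G (y %% Q)%N = G y) -> (forall x, 0 <= G x <= 1) ->
  0 <= lam -> (forall x, `|G x.+1 - G x| <= lam) ->
  0 < kap -> (forall k, (K < k < Q - K)%N -> kap <= `|z ^+ k - 1|) ->
  (2 * H * K < Q)%N ->
  (forall n, (0 < n <= H * K)%N -> (size (divisors n) <= r)%N) ->
  m = Q%:R^-1 * \sum_(x < Q) G x ->
  \sum_(x < Q) `|\sum_(h < H) (G (h.+1 * x)%N - m)| ^+ 2 <=
  2%:R * (Q%:R * (r%:R * (H%:R * m))) +
  2%:R * (Q%:R * (H%:R ^+ 2 * (Q%:R * (lam / kap) ^+ 2))).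
Proof.
move=> zP Gper G01 lam0 Glip kap0 zkap HK divr mdef.
have Q0 := prim_order_gt0 zP; have QC := prim_order_natr_neq0 zP.
have QCgt0 : 0 < Q%:R :> C by rewrite ltr0n.
pose c := dft Q z G.
have mE : m = c 0%N.
  rewrite mdef; congr (_ * _); apply: eq_bigr => x _.
  by rewrite mul0n expr0 rmorph1 mulr1.
pose high (k : 'I_Q) := (k != 0%N :> nat) && ~~ low_freq Q K k.
pose T1 (x : nat) := \sum_(p : 'I_H * 'I_Q | low_freq Q K p.2)
   c p.2 * z ^+ (p.1.+1 * p.2 * x).
pose T2 (x : nat) := \sum_(h < H) \sum_(k < Q | high k) c k * z ^+ (k * (h.+1 * x)).
have split_G y : G y - m =
    \sum_(k < Q | low_freq Q K k) c k * z ^+ (k * y) +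
    \sum_(k < Q | high k) c k * z ^+ (k * y).
  rewrite -[in LHS](dft_inversion y zP Gper) (bigD1 (Ordinal Q0)) //=.
  rewrite mul0n expr0 mulr1 -/(c 0%N) -mE addrAC subrr add0r.
  rewrite (bigID (fun k : 'I_Q => low_freq Q K k)) /=; congr (_ + _).
  apply: eq_bigl => k; rewrite -val_eqE /=.
  by rewrite /low_freq andbA andbb.
have TE (x : nat) : \sum_(h < H) (G (h.+1 * x)%N - m) = T1 x + T2 x.
  under eq_bigr do rewrite split_G.
  rewrite big_split /=; congr (_ + _).
  rewrite pair_big_dep /=; apply: eq_bigr => p _.
  by congr (_ * _ ^+ _); rewrite mulnA [(p.2 * _)%N]mulnC.
apply: (@le_trans _ _ (\sum_(x < Q) (2%:R * `|T1 x| ^+ 2 + 2%:R * `|T2 x| ^+ 2))).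
  by apply: ler_sum => x _; rewrite TE; apply: sqr_normD_le.
(* Since 0 <= G <= 1, G ^ 2 <= G. This makes the main term linear in m, which is what Chebyshev
   needs when m is small. *)
have cm : \sum_(k < Q) `|c k| ^+ 2 <= m.
  rewrite -(@ler_pM2l _ Q%:R) // mdef mulVKf //.
  apply: le_trans (dft_bessel G zP) _; apply: ler_sum => x _.
  have /andP[G0 G1] := G01 x.
  by rewrite ger0_norm // expr2 -[leRHS]mulr1 ler_wpM2l.
rewrite big_split /= -!mulr_sumr; apply: lerD; rewrite ler_wpM2l ?ler0n //.
  have fib (p : 'I_H * 'I_Q) : low_freq Q K p.2 ->
      (#|[pred q : 'I_H * 'I_Q | low_freq Q K q.2 &&
         (p.1.+1 * p.2 == q.1.+1 * q.2 %[mod Q])%N]| <= r)%N.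
    by move=> lowp; apply: card_low_fiber.
  have := exp_sum_sqr_le (D := fun p : 'I_H * 'I_Q => low_freq Q K p.2)
    (fun p => c p.2) (nu := fun p => (p.1.+1 * p.2)%N) zP fib.
  move=> /le_trans; apply.
  rewrite !ler_wpM2l ?ler0n //.
  rewrite -(pair_big_dep predT (fun (_ : 'I_H) (k : 'I_Q) => low_freq Q K k)
    (fun _ k => `|c k| ^+ 2)) /= sumr_const card_ord -[leLHS]mulr_natl.
  rewrite ler_wpM2l ?ler0n //; apply: le_trans cm.
  rewrite big_mkcond; apply: ler_sum => k _.
  by case: ifP; rewrite ?exprn_ge0.
rewrite [leRHS]mulr_natl -[X in _ *+ X]card_ord -sumr_const; apply: ler_sum => x _.
(* The high part is at most H t at every point, and t ^ 2 is at most Q times the tail of the squared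
   coefficients. *)
pose t := \sum_(k < Q | high k) `|c k|.
have t0 : 0 <= t by apply: sumr_ge0.
have T2t : `|T2 x| <= H%:R * t.
  apply: le_trans (ler_norm_sum _ _ _) _.
  rewrite [leRHS]mulr_natl -[X in _ *+ X]card_ord -sumr_const; apply: ler_sum => h _.
  apply: le_trans (ler_norm_sum _ _ _) _; apply: ler_sum => k _.
  by rewrite normrM (norm_prim_rootX _ zP) mulr1.
apply: (@le_trans _ _ ((H%:R * t) ^+ 2)).
  by rewrite lerXn2r ?nnegrE ?mulr_ge0 ?ler0n.
rewrite exprMn ler_wpM2l ?exprn_ge0 ?ler0n //.
apply: le_trans (sqr_sum_le _ (fun k : 'I_Q => normr_ge0 (c k))) _.
rewrite card_ord ler_wpM2l ?ler0n //.
apply: (dft_tail zP _ lam0 kap0 Glip); first by rewrite -Gper modnn.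
move=> k /andP[k0]; rewrite /low_freq k0 /= negb_or -!ltnNge => /andP[Kk kQ].
by apply: zkap; rewrite Kk ltn_subRL addnC.
Qed.

End Fourier.
End Fourier.

(** * Lower bounds for chords between roots of unity *)

Module Chord.

(** From sin x >= x - x^3 / 6 and x <= 2, which leaves at least (1 - 4/6) x. *)
Lemma third_le_sin x : 0 <= x <= PI / 2 -> x / 3 <= sin x.
Proof.
intros Hx. pose proof PI_4.
destruct (sin_bound x 0) as [Hs _]; [lra | lra |].
unfold sin_approx, sin_term in Hs; simpl in Hs.
nra.
Qed.

(** The reflection k -> Q - k reduces to 2k <= Q, where the previous bound applies; PI > 2 turns PI
    / 3 into at least 1 / 2. *)
Lemma sin_PI_frac_ge (Q K k : nat) : (K < k < Q - K)%nat ->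
  INR K / INR Q / 2 <= sin (PI * (INR k / INR Q)).
Proof.
intros Hk.
assert (HQ : 0 < INR Q) by (apply lt_0_INR; lia).
pose proof PI_RGT_0. pose proof PI2_1.
assert (Hr : forall j, (K <= j)%nat -> (2 * j <= Q)%nat ->
   INR K / INR Q / 2 <= sin (PI * (INR j / INR Q))).
{ intros j Hj HjQ. apply le_INR in Hj. apply le_INR in HjQ.
  rewrite mult_INR in HjQ. simpl in HjQ.
  assert (Hq : 0 <= INR j / INR Q <= 1 / 2).
  { split; [apply Rmult_le_pos; [apply pos_INR | left; apply Rinv_0_lt_compat; lra] |].
    apply Rmult_le_reg_r with (INR Q); [lra|]. unfold Rdiv.
    rewrite Rmult_assoc, Rinv_l by lra. lra. }
  assert (HK : INR K / INR Q <= INR j / INR Q).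
  { apply Rmult_le_compat_r; [left; apply Rinv_0_lt_compat; lra | lra]. }
  pose proof (third_le_sin (PI * (INR j / INR Q))). nra. }
destruct (Nat.le_gt_cases (2 * k) Q) as [H1|H1].
- apply Hr; lia.
- rewrite <- sin_PI_x.
  replace (PI - PI * (INR k / INR Q)) with (PI * (INR (Q - k) / INR Q)).
  + apply Hr; lia.
  + rewrite minus_INR by lia. field. lra.
Qed.

Lemma chord_sqr t : (cos (2 * t) - 1) ^ 2 + sin (2 * t) ^ 2 = (2 * sin t) ^ 2.
Proof.
rewrite cos_2a_sin, sin_2a.
replace ((2 * sin t * cos t) ^ 2) with (4 * (sin t) ^ 2 * (cos t * cos t)) by ring.
replace (cos t * cos t) with (1 - sin t * sin t).
- ring.
- pose proof (sin2_cos2 t). unfold Rsqr in *. lra.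
Qed.

Lemma chord_ge (Q K k : nat) : (K < k < Q - K)%nat ->
  INR K / INR Q <=
  sqrt ((cos (INR k * (2 * PI / INR Q)) - 1) ^ 2 + sin (INR k * (2 * PI / INR Q)) ^ 2).
Proof.
intros Hk. pose proof (sin_PI_frac_ge _ _ _ Hk) as H.
assert (HQ : 0 < INR Q) by (apply lt_0_INR; lia).
assert (0 <= INR K / INR Q)
  by (apply Rmult_le_pos; [apply pos_INR | left; apply Rinv_0_lt_compat; lra]).
replace (INR k * (2 * PI / INR Q)) with (2 * (PI * (INR k / INR Q))) by (field; lra).
rewrite chord_sqr, sqrt_pow2; lra.
Qed.

(** Serves to show that e(1/Q) has exact order Q. *)
Lemma cos_root_neq1 (Q k : nat) : (0 < k < Q)%nat ->
  cos (INR k * (2 * PI / INR Q)) <> 1.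
Proof.
intros Hk E.
assert (HQ : 0 < INR Q) by (apply lt_0_INR; lia).
assert (Hk0 : 0 < INR k) by (apply lt_0_INR; lia).
assert (HkQ : INR k < INR Q) by (apply lt_INR; lia).
replace (INR k * (2 * PI / INR Q)) with (2 * (PI * (INR k / INR Q))) in E by (field; lra).
rewrite cos_2a_sin in E. pose proof PI_RGT_0.
assert (0 < INR k / INR Q < 1).
{ split; [apply Rdiv_lt_0_compat; lra |].
  apply Rmult_lt_reg_r with (INR Q); [lra|]. unfold Rdiv.
  rewrite Rmult_assoc, Rinv_l by lra. lra. }
assert (0 < sin (PI * (INR k / INR Q))) by (apply sin_gt_0; nra).
nra.
Qed.
End Chord.

(** * Transfer to real-valued functions, and Chebyshev's inequality *)

Module Bridge.
Import all_boot all_order all_algebra complex Rstruct.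
Import Order.TTheory GRing.Theory Num.Theory.
Import Chord Divisors Fourier.
Set Implicit Arguments.
Unset Strict Implicit.
Local Open Scope ring_scope.
Local Open Scope complex_scope.
Delimit Scope R_scope with coqR.

Definition rootC (Q : nat) : R[i] := cos (2 * PI / INR Q)%coqR +i* sin (2 * PI / INR Q)%coqR.

Lemma rootCX Q k : rootC Q ^+ k =
  cos (INR k * (2 * PI / INR Q))%coqR +i* sin (INR k * (2 * PI / INR Q))%coqR.
Proof.
elim: k => [|k IH]; first by rewrite expr0 /= Rmult_0_l cos_0 sin_0.
rewrite exprSr IH S_INR Rmult_plus_distr_r Rmult_1_l /rootC cos_plus sin_plus.
by apply/eqP; rewrite eq_complex /=; apply/andP; split; apply/eqP;
  rewrite !(RmultE, RplusE, RminusE) // addrC.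
Qed.

Lemma rootC_prim Q : (0 < Q)%N -> Q.-primitive_root (rootC Q).
Proof.
move=> Q0; apply/andP; split=> //; apply/forallP => i.
rewrite unity_rootE rootCX; apply/eqP.
have [->|iQ] := eqVneq i.+1 Q.
  have -> : (INR Q * (2 * PI / INR Q))%coqR = (2 * PI)%coqR.
    by field; apply: not_0_INR; case: (Q) Q0.
  by rewrite cos_2PI sin_2PI; apply/eqP.
apply/negbTE/negP => /eqP[E _]; apply: (@cos_root_neq1 Q i.+1) E.
split; apply/ssrnat.ltP => //; by rewrite ltn_neqAle iQ ltn_ord.
Qed.

Lemma norm_rootCX_sub1 Q K k : (K < k < Q - K)%N ->
  (INR K / INR Q)%coqR%:C <= `|rootC Q ^+ k - 1|.
Proof.
move=> /andP[Kk kQ]; rewrite rootCX normc_def lecR -RsqrtE; apply/RleP.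
have := @chord_ge Q K k (conj (ssrnat.ltP Kk) (ssrnat.ltP kQ)).
by rewrite !RpowE /= subr0.
Qed.

(** The complex statement for z = e(1/Q), with kap = K / Q supplied by the chord bound. *)
Lemma dilation_variance_R (Q K H r : nat) (G : nat -> R) (lam m : R) :
  (0 < Q)%N -> (0 < K)%N ->
  (forall y, G (y %% Q)%N = G y) -> (forall x, 0 <= G x <= 1) ->
  0 <= lam -> (forall x, `|G x.+1 - G x| <= lam) ->
  (2 * H * K < Q)%N ->
  (forall n, (0 < n <= H * K)%N -> (size (divisors n) <= r)%N) ->
  m = Q%:R^-1 * \sum_(x < Q) G x ->
  \sum_(x < Q) (\sum_(h < H) (G (h.+1 * x)%N - m)) ^+ 2 <=
  2%:R * (Q%:R * (r%:R * (H%:R * m))) +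
  2%:R * (Q%:R * (H%:R ^+ 2 * (Q%:R * (lam / (K%:R / Q%:R)) ^+ 2))).
Proof.
move=> Q0 K0 Gper G01 lam0 Glip HK divr mE.
have kap0 : 0 < ((K%:R / Q%:R : R)%:C : R[i]).
  by rewrite ltcR divr_gt0 ?ltr0n.
have zkap k : (K < k < Q - K)%N -> (K%:R / Q%:R)%:C <= `|rootC Q ^+ k - 1|.
  by move=> /norm_rootCX_sub1; rewrite RdivE !INRE.
have Gper' y : (G (y %% Q)%N)%:C = (G y)%:C by rewrite Gper.
have G01' x : 0 <= (G x)%:C <= 1.
  by have /andP[G0 G1] := G01 x; rewrite ler0c G0 -[1]/(1%:C) lecR.
have Glip' x : `|(G x.+1)%:C - (G x)%:C| <= lam%:C.
  by rewrite -rmorphB /= normc_def /= expr0n addr0 sqrtr_sqr lecR.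
have mE' : m%:C = Q%:R^-1 * \sum_(x < Q) (G x)%:C.
  by rewrite mE rmorphM fmorphV rmorph_nat rmorph_sum.
have lam0' : 0 <= lam%:C by rewrite ler0c.
have := @dilation_variance _ Q K H r (rootC Q) _ _ _ _ (rootC_prim Q0)
  Gper' G01' lam0' Glip' kap0 zkap HK divr mE'.
rewrite -lecR !(rmorphD, rmorphM, rmorphXn, fmorphV, rmorph_nat) rmorph_sum /=.
move=> V; apply: le_trans V; rewrite le_eqVlt; apply/orP; left; apply/eqP.
apply: eq_bigr => x _; rewrite rmorphXn /= rmorph_sum /=.
rewrite -[RHS]normrX ger0_norm; last first.
  under eq_bigr do rewrite -rmorphB. 
  by rewrite -rmorph_sum -rmorphXn /= ler0c sqr_ge0.
by under eq_bigr do rewrite rmorphB.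
Qed.

Lemma ssumE (f : nat -> R) n : ssum f n = \sum_(i < n) f i.+1.
Proof. by elim: n => [|n IH]; rewrite ?big_ord0 // big_ord_recr /= -IH. Qed.

(** Chebyshev: at a point x with G (h x) = 0 for all h <= H, the inner sum of the variance is -Hm,
    so each such x contributes (Hm)^2. The points are returned as a list because they will index the
    covering intervals. *)
Theorem few_annihilated_points (Q K H r : nat) (G : nat -> R) (lam m : R) :
  (0 < Q)%coq_nat -> (0 < K)%coq_nat ->
  (forall y, G (y + Q)%coq_nat = G y) -> (forall x, (0 <= G x <= 1)%coqR) ->
  (forall x, (Rabs (G (S x) - G x) <= lam)%coqR) ->
  (2 * H * K < Q)%coq_nat ->
  (forall n, (0 < n)%coq_nat -> (n <= H * K)%coq_nat -> (size (divisors n) <= r)%coq_nat) ->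
  m = (ssum G Q / INR Q)%coqR ->
  exists l : list nat,
    (forall x, (x < Q)%coq_nat ->
       (forall h, (1 <= h)%coq_nat -> (h <= H)%coq_nat -> G (h * x)%coq_nat = 0%coqR) -> In x l) /\
    (INR (length l) * (INR H * m) ^ 2 <=
     2 * (INR Q * (INR r * (INR H * m))) +
     2 * (INR Q * (INR H ^ 2 * (INR Q * (lam / (INR K / INR Q)) ^ 2))))%coqR.
Proof.
move=> /ssrnat.ltP Q0 /ssrnat.ltP K0 Gper G01 Glip /ssrnat.ltP HK divr mE.
have Gmod y : G (y %% Q)%N = G y.
  rewrite [in RHS](divn_eq y Q); elim: (y %/ Q)%N => [|n IH] //.
  by rewrite mulSn -addnA addnC -plusE Gper.
have G01' x : 0 <= G x <= 1.
  by have [/RleP G0 /RleP G1] := G01 x; rewrite G0.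
have Glip' x : `|G x.+1 - G x| <= lam.
  by have /RleP := Glip x; rewrite RabsE.
have lam0 : 0 <= lam by apply: le_trans (Glip' 0%N).
have divr' n : (0 < n <= H * K)%N -> (size (divisors n) <= r)%N.
  by move=> /andP[/ssrnat.ltP n0 /ssrnat.leP nHK]; apply/ssrnat.leP/divr.
have mE' : m = Q%:R^-1 * \sum_(x < Q) G x.
  (* [ssum] runs over 1, ..., Q and the big sum over 0, ..., Q - 1; periodicity identifies them. *)
  have GQ : G Q = G 0%N by rewrite -Gmod modnn.
  by rewrite mE RdivE INRE ssumE (sum_ordS GQ) mulrC.
have V := dilation_variance_R Q0 K0 Gmod G01' lam0 Glip' HK divr' mE'.
pose bad := [set x : 'I_Q | [forall h : 'I_H, G (h.+1 * x)%N == 0]].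
exists (map val (enum bad)); split.
  move=> x /ssrnat.ltP xQ bx.
  have : x \in map val (enum bad).
    apply/mapP; exists (Ordinal xQ) => //; rewrite mem_enum inE.
    apply/forallP => h; apply/eqP; apply: bx; [exact/ssrnat.leP | exact/ssrnat.leP/ltn_ord].
  elim: (map _ _) => [|a l IH] //; rewrite inE => /orP[/eqP ->|/IH]; [by left|by right].
apply/RleP.
have two : IZR 2 = 2%:R :> R by rewrite -INRE.
rewrite !RpowE !(RmultE, RplusE, RdivE) !INRE two.
apply: le_trans V.
have -> : length [seq \val i | i <- enum bad] = #|bad|.
  by rewrite -[length _]/(size _) size_map -cardE.
rewrite mulr_natl -sumr_const big_mkcond /=; apply: ler_sum => x _.
case: ifP => [|_]; last exact: sqr_ge0.
rewrite inE => /forallP bx.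
rewrite (eq_bigr (fun=> - m)) => [|h _]; last by rewrite (eqP (bx h)) sub0r.
by rewrite sumr_const card_ord mulNrn sqrrN mulr_natl.
Qed.

Lemma divisor_bound_R s : (0 < s)%coq_nat -> exists C : nat, forall n,
  (0 < n)%coq_nat -> (INR (size (divisors n)) ^ s <= INR C * INR n)%coqR.
Proof.
move=> /ssrnat.ltP s0; have [C HC] := divisor_bound s0; exists C => n /ssrnat.ltP n0.
by apply/RleP; rewrite RpowE RmultE !INRE -natrX -natrM ler_nat HC.
Qed.

Lemma pow_le_pow2 s j : (0 < s)%coq_nat -> (INR j ^ s <= INR s ^ s * 2 ^ j)%coqR.
Proof.
move=> /ssrnat.ltP s0; have two : IZR 2 = 2%:R :> R by rewrite -INRE.
apply/RleP; rewrite !RpowE RmultE !INRE two -!natrX -natrM ler_nat.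
by apply: leq_trans (expn_succ_le j s0); rewrite leq_exp2r.
Qed.
End Bridge.

(** * Koksma's inequality *)

Module Koksma.
Import Coquelicot.

Lemma ssum_ext f g n : (forall k, (1 <= k <= n)%nat -> f k = g k) -> ssum f n = ssum g n.
Proof.
induction n as [|n IH]; intros H; simpl; [reflexivity|].
rewrite IH, H; [reflexivity | lia |]. intros k Hk; apply H; lia.
Qed.

Lemma ssum_le f g n : (forall k, (1 <= k <= n)%nat -> f k <= g k) -> ssum f n <= ssum g n.
Proof.
induction n as [|n IH]; intros H; simpl; [lra|].
apply Rplus_le_compat; [apply IH; intros k Hk; apply H; lia | apply H; lia].
Qed.

Lemma ssum_plus f g n : ssum (fun k => f k + g k) n = ssum f n + ssum g n.
Proof. induction n as [|n IH]; simpl; [|rewrite IH]; ring. Qed.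

Lemma ssum_scal c f n : ssum (fun k => c * f k) n = c * ssum f n.
Proof. induction n as [|n IH]; simpl; [|rewrite IH]; ring. Qed.

Lemma ssum_const c n : ssum (fun _ => c) n = INR n * c.
Proof. induction n as [|n IH]; [simpl; ring|]. rewrite S_INR; simpl; rewrite IH; ring. Qed.

Lemma Rabs_ssum f n : Rabs (ssum f n) <= ssum (fun k => Rabs (f k)) n.
Proof.
induction n as [|n IH]; simpl; [rewrite Rabs_R0; lra|].
eapply Rle_trans; [apply Rabs_triang|lra].
Qed.

Lemma discrepancy_ge x N t : (0 < N)%nat -> (forall n, 0 <= x n) -> 0 <= t <= 1 ->
  Rabs (INR (count_in x 0 t N) - INR N * t) <= INR N * discrepancy x N.
Proof.
intros HN Hx Ht. assert (HNR : 0 < INR N) by (apply lt_0_INR; lia).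
unfold discrepancy; destruct (completeness _ _ _) as [D HD]; simpl; destruct HD as [HD _].
assert (key : forall b, 0 < b <= 1 ->
  Rabs (INR (count_in x 0 b N) - INR N * b) <= INR N * D).
{ intros b Hb.
  assert (H : Rabs (INR (count_in x 0 b N) / INR N - (b - 0)) <= D).
  { apply HD. exists 0, b. repeat split; try lra. }
  replace (INR (count_in x 0 b N) - INR N * b)
    with (INR N * (INR (count_in x 0 b N) / INR N - (b - 0))) by (field; lra).
  rewrite Rabs_mult, (Rabs_pos_eq (INR N)) by lra.
  apply Rmult_le_compat_l; lra. }
destruct (Rle_lt_or_eq_dec 0 t (proj1 Ht)) as [H0|<-]; [apply key; lra|].
(* [disc_set] only admits a < b, so t = 0 is treated apart: nothing is counted, and the discrepancy
   is nonnegative. *)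
assert (H0 : count_in x 0 0 N = 0%nat).
{ clear -Hx. induction N as [|n IH]; simpl; [reflexivity|]. rewrite IH.
  destruct (Rle_dec 0 (x (S n))); [|reflexivity].
  destruct (Rlt_dec (x (S n)) 0); [|reflexivity]. specialize (Hx (S n)); lra. }
rewrite H0. simpl. rewrite Rmult_0_r, Rminus_0_r, Rabs_R0.
apply Rmult_le_pos; [lra|].
eapply Rle_trans; [apply Rabs_pos|apply HD]. exists 0, 1. repeat split; lra.
Qed.

Section CountingFunction.
Context (g g' : R -> R).
Context (g_deriv : forall t, is_derive g t (g' t)).
Context (g'_cont : forall t, continuous g' t).

Lemma is_RInt_deriv a b : is_RInt g' a b (g b - g a).
Proof. now apply (is_RInt_derive g g' a b). Qed.

(** The point x k is counted exactly when t > x k, so its share is the integral of g' from x k to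
    1. *)
Lemma is_RInt_deriv_count x n : (forall k, 0 <= x k < 1) ->
  is_RInt (fun t => g' t * INR (count_in x 0 t n)) 0 1
    (ssum (fun k => g 1 - g (x k)) n).
Proof.
intros Hx. induction n as [|n IH]; simpl.
- apply (is_RInt_ext (fun _ => 0)); [intros; simpl; ring|].
  evar_last; [apply (is_RInt_const 0 1 0) | apply Rmult_0_r].
- apply (is_RInt_ext (fun t => plus (g' t * INR (count_in x 0 t n))
     (g' t * (if Rlt_dec (x (S n)) t then 1 else 0)))).
  { intros t _. destruct (Hx (S n)) as [H0 _].
    rewrite plus_INR. destruct (Rle_dec 0 (x (S n))); [|lra].
    destruct (Rlt_dec (x (S n)) t); unfold plus; simpl; ring. }
  apply (is_RInt_plus _ _ _ _ _ _ IH).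
  destruct (Hx (S n)) as [H0 H1].
  replace (g 1 - g (x (S n))) with (plus 0 (g 1 - g (x (S n)))) by apply Rplus_0_l.
  apply (is_RInt_Chasles (V := R_NormedModule) _ 0 (x (S n)) 1).
  + apply (is_RInt_ext (fun _ => 0)).
    { intros t Ht. rewrite Rmin_left, Rmax_right in Ht by lra.
      destruct (Rlt_dec (x (S n)) t); simpl; lra. }
    evar_last; [apply (is_RInt_const 0 (x (S n)) 0) | apply Rmult_0_r].
  + apply (is_RInt_ext g').
    { intros t Ht. rewrite Rmin_left, Rmax_right in Ht by lra.
      destruct (Rlt_dec (x (S n)) t); simpl; lra. }
    apply is_RInt_deriv.
Qed.

(* Integration by parts against the counting function. *)
Theorem koksma x N M : (0 < N)%nat -> (forall k, 0 <= x k < 1) ->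
  is_RInt g 0 1 0 -> (forall t, 0 <= t <= 1 -> Rabs (g' t) <= M) ->
  Rabs (ssum (fun k => g (x k)) N) <= M * (INR N * discrepancy x N).
Proof.
intros HN Hx Hg HM.
(* Integration by parts; the remaining integral of g vanishes by hypothesis. Below, the two
   multiples of g 1 cancel and leave minus the sum of g over the points. *)
assert (Ht : is_RInt (fun t => t * g' t) 0 1 (g 1)).
{ apply (is_RInt_ext (fun t => minus (g t + t * g' t) (g t))).
  { intros t _. unfold minus, plus, opp; simpl; ring. }
  replace (g 1) with (minus (1 * g 1 - 0 * g 0) 0)
    by (unfold minus, plus, opp; simpl; ring).
  apply (is_RInt_minus (V := R_NormedModule) (fun t => g t + t * g' t) g 0 1
    (1 * g 1 - 0 * g 0) 0); [|exact Hg].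
  apply (is_RInt_derive (fun t => t * g t) (fun t => g t + t * g' t)).
  - intros t _. evar_last.
    + apply (is_derive_mult (fun t => t) g t 1 (g' t));
        [apply (is_derive_id (K := R_AbsRing)) | apply g_deriv |].
      intros; apply Rmult_comm.
    + unfold plus, mult; simpl. unfold mult; simpl. ring.
  - intros t _. apply (continuous_plus g).
    + apply ex_derive_continuous. exists (g' t); apply g_deriv.
    + apply (continuous_mult (fun t => t) g'); [apply continuous_id | apply g'_cont]. }
assert (HI : is_RInt (fun t => g' t * (INR (count_in x 0 t N) - INR N * t)) 0 1
   (- ssum (fun k => g (x k)) N)).
{ apply (is_RInt_ext (fun t => minus (g' t * INR (count_in x 0 t N))
     (scal (INR N) (t * g' t)))).
  { intros t _. unfold minus, plus, opp, scal; simpl. unfold mult; simpl. ring. }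
  replace (- ssum (fun k => g (x k)) N)
    with (minus (ssum (fun k => g 1 - g (x k)) N) (scal (INR N) (g 1))).
  - apply (is_RInt_minus (V := R_NormedModule)); [exact (is_RInt_deriv_count x N Hx)|].
    exact (is_RInt_scal (V := R_NormedModule) _ _ _ (INR N) _ Ht).
  - rewrite (ssum_ext _ (fun k => g 1 + -1 * g (x k))) by (intros; ring).
    rewrite ssum_plus, ssum_const, ssum_scal.
    unfold minus, plus, opp, scal; simpl. unfold mult; simpl. ring. }
rewrite <- Rabs_Ropp.
replace (M * (INR N * discrepancy x N))
  with ((1 - 0) * (M * (INR N * discrepancy x N))) by ring.
apply (norm_RInt_le_const _ 0 1 _ _ Rle_0_1) with (2 := HI).
intros t Ht01. change norm with Rabs. rewrite Rabs_mult.
apply Rmult_le_compat; try apply Rabs_pos; [now apply HM|].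
apply discrepancy_ge; [exact HN | intros; apply Hx | exact Ht01].
Qed.
End CountingFunction.

(** * Exponential sums: discrepancy, Lipschitz and size bounds *)

Lemma cos_add_2PI_Z x z : cos (x + 2 * IZR z * PI) = cos x.
Proof.
assert (E : forall p, IZR (Zpos p) = INR (Pos.to_nat p)).
{ intros p. now rewrite INR_IZR_INZ, Znat.positive_nat_Z. }
destruct z as [|p|p].
- f_equal; ring.
- rewrite (E p). apply cos_period.
- change (Zneg p) with (- Zpos p)%Z. rewrite opp_IZR, (E p).
  rewrite <- (cos_period _ (Pos.to_nat p)). f_equal; ring.
Qed.

Lemma sin_add_2PI_Z x z : sin (x + 2 * IZR z * PI) = sin x.
Proof.
rewrite <- !cos_shift.
replace (PI / 2 - (x + 2 * IZR z * PI)) with (PI / 2 - x + 2 * IZR (- z) * PI)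
  by (rewrite opp_IZR; ring).
apply cos_add_2PI_Z.
Qed.

Lemma exp_sum_abs_eq a N x y :
  (forall n, exists z : Z, IZR (a n) * x = IZR (a n) * y + IZR z) ->
  exp_sum_abs a N x = exp_sum_abs a N y.
Proof.
intros H. unfold exp_sum_abs.
assert (E : forall n, exists z, 2 * PI * IZR (a n) * x = 2 * PI * IZR (a n) * y + 2 * IZR z * PI).
{ intros n. destruct (H n) as [z Hz]. exists z. rewrite Rmult_assoc, Hz. ring. }
apply (f_equal sqrt), f_equal2; apply (f_equal (fun u => u ^ 2)), ssum_ext;
  intros n _; destruct (E n) as [z ->].
- apply cos_add_2PI_Z.
- apply sin_add_2PI_Z.
Qed.

Lemma sqrt_sqr_sum_Rabs x y : sqrt (x ^ 2 + y ^ 2) <= Rabs x + Rabs y.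
Proof.
pose proof (Rabs_pos x); pose proof (Rabs_pos y).
rewrite <- (sqrt_pow2 (Rabs x + Rabs y)) by lra. apply sqrt_le_1_alt.
rewrite <- (pow2_abs x), <- (pow2_abs y). nra.
Qed.

(** Cauchy-Schwarz in the plane, read off Lagrange's identity. *)
Lemma abs_linear_trig_le u v c s : c ^ 2 + s ^ 2 = 1 ->
  Rabs (v * c - u * s) <= sqrt (u ^ 2 + v ^ 2).
Proof.
intros Hcs. rewrite <- (sqrt_pow2 (Rabs (v * c - u * s))) by apply Rabs_pos.
apply sqrt_le_1_alt. rewrite pow2_abs.
assert ((v * c - u * s) ^ 2 + (u * c + v * s) ^ 2 = (u ^ 2 + v ^ 2) * (c ^ 2 + s ^ 2)) by ring.
rewrite Hcs in H. pose proof (pow2_ge_0 (u * c + v * s)). lra.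
Qed.

(** To stay with real functions, Koksma is applied to g(t) = c cos(wt) + s sin(wt), where w = 2 PI h
    and c, s are the real and imaginary parts of the sum itself. With r the modulus of the sum, g
    sums to r^2 over the points while |g'| <= w r; divide by r. The mean of g vanishes because h is
    a positive integer. *)
Theorem exp_sum_abs_le_discrepancy a N h alpha : (0 < N)%nat -> (0 < h)%nat ->
  exp_sum_abs a N (INR h * alpha) <=
  2 * PI * INR h * (INR N * discrepancy (fun n => frac_part (IZR (a n) * alpha)) N).
Proof.
intros HN Hh. set (x := fun n => frac_part (IZR (a n) * alpha)).
assert (Hx : forall k, 0 <= x k < 1).
{ intros k. destruct (base_fp (IZR (a k) * alpha)). unfold x; lra. }
assert (HhR : 0 < INR h) by (apply lt_0_INR; lia).
pose proof PI_RGT_0 as HPI.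
set (w := 2 * PI * INR h).
assert (Hw : 0 < w) by (unfold w; nra).
set (c := ssum (fun n => cos (w * x n)) N).
set (s := ssum (fun n => sin (w * x n)) N).
(* As h is an integer, the integral part of a_n alpha only shifts the angle by a multiple of 2
   PI. *)
assert (E : exp_sum_abs a N (INR h * alpha) = sqrt (c ^ 2 + s ^ 2)).
{ assert (A : forall n, 2 * PI * IZR (a n) * (INR h * alpha) =
     w * x n + 2 * IZR (Z.of_nat h * Int_part (IZR (a n) * alpha)) * PI).
  { intros n. rewrite mult_IZR, <- INR_IZR_INZ. unfold w, x.
    replace (2 * PI * IZR (a n) * (INR h * alpha))
      with (2 * PI * INR h * (IZR (a n) * alpha)) by ring.
    rewrite (Rplus_Int_part_frac_part (IZR (a n) * alpha)) at 1. ring. }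
  unfold exp_sum_abs, c, s.
  apply (f_equal sqrt), f_equal2; apply (f_equal (fun u => u ^ 2)), ssum_ext;
    intros n _; rewrite A.
  - apply cos_add_2PI_Z.
  - apply sin_add_2PI_Z. }
rewrite E. set (r := sqrt (c ^ 2 + s ^ 2)).
assert (Hr : 0 <= r) by apply sqrt_pos.
assert (Hr2 : r * r = c ^ 2 + s ^ 2) by (apply sqrt_sqrt; nra).
set (g := fun t => c * cos (w * t) + s * sin (w * t)).
set (g' := fun t => w * (s * cos (w * t) - c * sin (w * t))).
assert (K : Rabs (ssum (fun k => g (x k)) N) <= w * r * (INR N * discrepancy x N)).
{ apply (koksma g g').
  - intros t. unfold g, g'. auto_derive; [trivial|ring].
  - intros t. apply (ex_derive_continuous (V := R_NormedModule)). unfold g'. auto_derive. trivial.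
  - exact HN.
  - exact Hx.
  - set (G := fun t => / w * (c * sin (w * t) - s * cos (w * t))).
    evar_last.
    + apply (is_RInt_derive G g).
      * intros t _. unfold G, g. auto_derive; [trivial|field; lra].
      * intros t _. apply (ex_derive_continuous (V := R_NormedModule)). unfold g. auto_derive. trivial.
    + unfold minus, plus, opp, G; simpl.
      assert (Hw1 : w * 1 = 0 + 2 * INR h * PI) by (unfold w; ring).
      rewrite Hw1, sin_period, cos_period, Rmult_0_r. ring.
  - intros t _. unfold g'. rewrite Rabs_mult, (Rabs_pos_eq w) by lra.
    apply Rmult_le_compat_l; [lra|]. unfold r. apply abs_linear_trig_le.
    pose proof (sin2_cos2 (w * t)). unfold Rsqr in *. lra. }
assert (Hs : ssum (fun k => g (x k)) N = r * r).
{ unfold g. rewrite ssum_plus, !ssum_scal. fold c s. rewrite Hr2. ring. }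
rewrite Hs, Rabs_pos_eq in K by nra.
destruct (Rle_lt_or_eq_dec 0 r Hr) as [H0|<-].
- apply Rmult_le_reg_l with r; [exact H0|]. fold w. lra.
- apply Rmult_le_pos; [lra|].
  eapply Rle_trans; [apply Rabs_pos|].
  apply (discrepancy_ge x N 0 HN); [intros; apply Hx | lra].
Qed.

Lemma lipschitz_of_deriv_le_1 f df x y : (forall t, is_derive f t (df t)) ->
  (forall t, Rabs (df t) <= 1) -> Rabs (f x - f y) <= Rabs (x - y).
Proof.
intros Hf Hdf. destruct (MVT_gen f y x df) as [t [_ Ht]].
- intros t _; apply Hf.
- intros t _. apply derivable_continuous_pt. exists (df t). apply is_derive_Reals, Hf.
- rewrite Ht, Rabs_mult. pose proof (Hdf t). pose proof (Rabs_pos (x - y)). nra.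
Qed.

Lemma Rabs_cos_sub x y : Rabs (cos x - cos y) <= Rabs (x - y).
Proof.
apply (lipschitz_of_deriv_le_1 cos (fun t => - sin t)).
- intros t. auto_derive; [trivial|ring].
- intros t. rewrite Rabs_Ropp. apply Rabs_le. pose proof (SIN_bound t). lra.
Qed.

Lemma Rabs_sin_sub x y : Rabs (sin x - sin y) <= Rabs (x - y).
Proof.
apply (lipschitz_of_deriv_le_1 sin cos).
- intros t. auto_derive; [trivial|ring].
- intros t. apply Rabs_le. pose proof (COS_bound t). lra.
Qed.

Lemma sqrt_sqr_sum_lipschitz a b c d :
  sqrt (a ^ 2 + b ^ 2) <= sqrt (c ^ 2 + d ^ 2) + Rabs (a - c) + Rabs (b - d).
Proof.
pose proof (Rabs_pos (a - c)) as Hp; pose proof (Rabs_pos (b - d)) as Hq.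
set (r := sqrt (c ^ 2 + d ^ 2)).
assert (Hr : 0 <= r) by apply sqrt_pos.
assert (Hr2 : r * r = c ^ 2 + d ^ 2) by (apply sqrt_sqrt; nra).
set (p := Rabs (a - c)) in *; set (q := Rabs (b - d)) in *.
rewrite <- (sqrt_pow2 (r + p + q)) by lra. apply sqrt_le_1_alt.
assert (Hp2 : (a - c) ^ 2 = p ^ 2) by (symmetry; apply pow2_abs).
assert (Hq2 : (b - d) ^ 2 = q ^ 2) by (symmetry; apply pow2_abs).
assert (Ha : c * (a - c) <= r * p).
{ assert (Rabs c <= r).
  { unfold r. rewrite <- (sqrt_pow2 (Rabs c)) by apply Rabs_pos.
    apply sqrt_le_1_alt. rewrite pow2_abs. nra. }
  eapply Rle_trans; [apply Rle_abs|]. rewrite Rabs_mult. fold p.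
  apply Rmult_le_compat_r; lra. }
assert (Hb : d * (b - d) <= r * q).
{ assert (Rabs d <= r).
  { unfold r. rewrite <- (sqrt_pow2 (Rabs d)) by apply Rabs_pos.
    apply sqrt_le_1_alt. rewrite pow2_abs. nra. }
  eapply Rle_trans; [apply Rle_abs|]. rewrite Rabs_mult. fold q.
  apply Rmult_le_compat_r; lra. }
replace (a ^ 2 + b ^ 2) with
  (c ^ 2 + d ^ 2 + 2 * (c * (a - c)) + 2 * (d * (b - d)) + (a - c) ^ 2 + (b - d) ^ 2) by ring.
rewrite Hp2, Hq2. nra.
Qed.

(** Each of the N terms of the cosine sum and of the sine sum is Lipschitz with constant 2 PI A; the
    two sums together give 4 PI. The one-sided form yields the two-sided one by exchanging x and
    y. *)
Lemma exp_sum_abs_lipschitz a N A x y :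
  (forall n, (1 <= n <= N)%nat -> Rabs (IZR (a n)) <= A) ->
  exp_sum_abs a N x <= exp_sum_abs a N y + 4 * PI * INR N * A * Rabs (x - y).
Proof.
intros HA. unfold exp_sum_abs. pose proof PI_RGT_0.
assert (key : forall f, (forall u v, Rabs (f u - f v) <= Rabs (u - v)) ->
  Rabs (ssum (fun n => f (2 * PI * IZR (a n) * x)) N -
        ssum (fun n => f (2 * PI * IZR (a n) * y)) N) <= 2 * PI * INR N * A * Rabs (x - y)).
{ intros f Hf.
  replace (ssum (fun n => f (2 * PI * IZR (a n) * x)) N -
        ssum (fun n => f (2 * PI * IZR (a n) * y)) N)
   with (ssum (fun n => f (2 * PI * IZR (a n) * x) + -1 * f (2 * PI * IZR (a n) * y)) N)
   by (rewrite ssum_plus, ssum_scal; ring).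
  eapply Rle_trans; [apply Rabs_ssum|].
  replace (2 * PI * INR N * A * Rabs (x - y))
    with (ssum (fun _ => 2 * PI * A * Rabs (x - y)) N) by (rewrite ssum_const; ring).
  apply ssum_le. intros n Hn.
  replace (f (2 * PI * IZR (a n) * x) + -1 * f (2 * PI * IZR (a n) * y))
    with (f (2 * PI * IZR (a n) * x) - f (2 * PI * IZR (a n) * y)) by ring.
  eapply Rle_trans; [apply Hf|].
  rewrite <- Rmult_minus_distr_l, !Rabs_mult, (Rabs_pos_eq 2), (Rabs_pos_eq PI) by lra.
  pose proof (HA n Hn). pose proof (Rabs_pos (x - y)).
  apply Rmult_le_compat_r; [lra|]. nra. }
pose proof (key cos Rabs_cos_sub). pose proof (key sin Rabs_sin_sub).
eapply Rle_trans; [apply (sqrt_sqr_sum_lipschitz _ _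
  (ssum (fun n => cos (2 * PI * IZR (a n) * y)) N)
  (ssum (fun n => sin (2 * PI * IZR (a n) * y)) N))|].
lra.
Qed.

Lemma exp_sum_abs_le a N x : exp_sum_abs a N x <= 2 * INR N.
Proof.
unfold exp_sum_abs. eapply Rle_trans; [apply sqrt_sqr_sum_Rabs|].
assert (key : forall f : R -> R, (forall u, -1 <= f u <= 1) ->
   Rabs (ssum (fun n => f (2 * PI * IZR (a n) * x)) N) <= INR N).
{ intros f Hf. eapply Rle_trans; [apply Rabs_ssum|].
  rewrite <- (Rmult_1_r (INR N)), <- ssum_const. apply ssum_le.
  intros n _. apply Rabs_le, Hf. }
pose proof (key cos COS_bound). pose proof (key sin SIN_bound). lra.
Qed.

(** On each cell f is compared with its value at the right endpoint, since [ssum] starts at 1; the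
    error per cell is at most Lam / Q times its length 1 / Q. *)
Lemma RiemannInt_le_ssum f Lam Q (pr : Riemann_integrable f 0 1) : (0 < Q)%nat ->
  (forall x y, f x <= f y + Lam * Rabs (x - y)) ->
  RiemannInt pr <= ssum (fun k => f (INR k / INR Q)) Q / INR Q + Lam / INR Q.
Proof.
intros HQ Hf. rewrite <- RInt_Reals.
assert (HQR : 0 < INR Q) by (apply lt_0_INR; lia).
assert (HL : 0 <= Lam).
{ pose proof (Hf 0 1). pose proof (Hf 1 0).
  rewrite Rminus_0_r, Rabs_R1 in H0. rewrite Rabs_minus_sym, Rminus_0_r, Rabs_R1 in H. lra. }
assert (Hex : forall u v, 0 <= u -> u <= v -> v <= 1 -> ex_RInt f u v).
{ intros u v Hu Huv Hv. apply ex_RInt_Reals_1 in pr.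
  apply (ex_RInt_Chasles_1 (V := R_CompleteNormedModule) f u v 1); [lra|].
  apply (ex_RInt_Chasles_2 (V := R_CompleteNormedModule) f 0 u 1); [lra|exact pr]. }
assert (key : forall j, (j <= Q)%nat ->
  RInt f 0 (INR j / INR Q) <=
  ssum (fun k => f (INR k / INR Q)) j / INR Q + INR j / INR Q * (Lam / INR Q)).
{ induction j as [|j IH]; intros Hj.
  - simpl. unfold Rdiv. rewrite !Rmult_0_l, RInt_point. unfold zero; simpl. lra.
  - specialize (IH ltac:(lia)).
    assert (H0 : 0 <= INR j / INR Q).
    { apply Rmult_le_pos; [apply pos_INR|left; apply Rinv_0_lt_compat; lra]. }
    assert (HS : INR (S j) / INR Q = INR j / INR Q + / INR Q) by (rewrite S_INR; field; lra).
    pose proof (Rinv_0_lt_compat _ HQR).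
    assert (H1 : INR (S j) / INR Q <= 1).
    { apply le_INR in Hj. apply Rmult_le_reg_r with (INR Q); [lra|].
      unfold Rdiv. rewrite Rmult_assoc, Rinv_l by lra. lra. }
    rewrite <- (RInt_Chasles f 0 (INR j / INR Q)) by (apply Hex; lra).
    assert (Hl : RInt f (INR j / INR Q) (INR (S j) / INR Q) <=
       / INR Q * (f (INR (S j) / INR Q) + Lam / INR Q)).
    { replace (/ INR Q * (f (INR (S j) / INR Q) + Lam / INR Q))
        with (RInt (fun _ => f (INR (S j) / INR Q) + Lam / INR Q)
                (INR j / INR Q) (INR (S j) / INR Q)).
      - apply RInt_le; [lra | apply Hex; lra | apply ex_RInt_const |].
        intros t Ht. eapply Rle_trans; [apply (Hf _ (INR (S j) / INR Q))|].
        apply Rplus_le_compat_l. unfold Rdiv at 2. apply Rmult_le_compat_l; [exact HL|].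
        rewrite Rabs_left1 by lra. lra.
      - rewrite RInt_const, HS. unfold scal; simpl. unfold mult; simpl. ring. }
    change (RInt f 0 (INR j / INR Q) + RInt f (INR j / INR Q) (INR (S j) / INR Q) <=
      (ssum (fun k => f (INR k / INR Q)) j + f (INR (S j) / INR Q)) / INR Q +
      INR (S j) / INR Q * (Lam / INR Q)).
    rewrite HS in *.
    eapply Rle_trans; [apply Rplus_le_compat; [exact IH|exact Hl]|].
    right. field. lra. }
specialize (key Q (Nat.le_refl Q)).
replace (INR Q / INR Q) with 1 in key by (field; lra).
lra.
Qed.
End Koksma.

Import Koksma.

(** * Null sets *)

Definition interval_total (l : list (R * R)) : R :=
  fold_right (fun I s => (snd I - fst I) + s) 0 l.

Lemma interval_total_app l1 l2 :
  interval_total (l1 ++ l2) = interval_total l1 + interval_total l2.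
Proof. induction l1 as [|I l IH]; simpl; [|rewrite IH]; ring. Qed.

Lemma interval_total_nonneg l : (forall I, In I l -> fst I <= snd I) -> 0 <= interval_total l.
Proof.
induction l as [|I l IH]; simpl; intros H; [lra|].
pose proof (H I (or_introl eq_refl)).
assert (0 <= interval_total l) by (apply IH; intros; apply H; now right). lra.
Qed.

(** Indices past the end of [l] read the default (0, 0), an interval of length zero, so a finite
    list serves as an infinite sequence. *)
Lemma sum_nth_le_interval_total l n : (forall I, In I l -> fst I <= snd I) ->
  sum_f_R0 (fun k => snd (nth k l (0, 0)) - fst (nth k l (0, 0))) n <= interval_total l.
Proof.
revert n; induction l as [|I l IH]; intros n H.
- right. simpl. rewrite <- (sum_eq (fun _ => 0)).
  + rewrite sum_cte. ring.
  + intros [|k] _; simpl; ring.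
- assert (Hl : forall J, In J l -> fst J <= snd J) by (intros; apply H; now right).
  destruct n as [|n].
  + pose proof (interval_total_nonneg l Hl). simpl. lra.
  + rewrite decomp_sum by lia. simpl.
    apply Rplus_le_compat_l, IH, Hl.
Qed.

Lemma nth_In_fst_le_snd l k : (forall I : R * R, In I l -> fst I <= snd I) ->
  fst (nth k l (0, 0)) <= snd (nth k l (0, 0)).
Proof.
intros H. destruct (Nat.lt_ge_cases k (length l)) as [Hk|Hk].
- apply H, nth_In, Hk.
- rewrite nth_overflow by lia. simpl; lra.
Qed.

(* The degenerate interval (0, 0) makes every block non-empty, so that a k-th
   interval already occurs among the first k + 1 blocks. *)
Section Concat.
Context (F : nat -> list (R * R)).

Fixpoint concat_upto (p : nat) : list (R * R) :=
  match p with
  | O => (0, 0) :: F O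
  | S q => concat_upto q ++ (0, 0) :: F (S q)
  end.

Lemma length_concat_upto p : (p < length (concat_upto p))%nat.
Proof. induction p as [|p IH]; simpl; [lia|]. rewrite length_app; simpl; lia. Qed.

Lemma nth_concat_upto k p : (k <= p)%nat ->
  nth k (concat_upto p) (0, 0) = nth k (concat_upto k) (0, 0).
Proof.
induction 1 as [|p Hkp IH]; [reflexivity|]. simpl.
rewrite app_nth1; [exact IH|]. pose proof (length_concat_upto p). lia.
Qed.

Lemma In_concat_upto I p : In I (F p) -> In I (concat_upto p).
Proof. destruct p; simpl; [tauto|]. intros H. apply in_or_app. right; now right. Qed.

Lemma concat_upto_fst_le_snd p : (forall q I, In I (F q) -> fst I <= snd I) ->
  forall I, In I (concat_upto p) -> fst I <= snd I.
Proof.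
intros H. induction p as [|p IH]; simpl; intros I.
- intros [<-|HI]; [simpl; lra | now apply (H 0%nat)].
- intros HI. apply in_app_or in HI. destruct HI as [HI|[<-|HI]]; [now apply IH | simpl; lra |].
  now apply (H (S p)).
Qed.

Lemma interval_total_concat_upto eps p :
  (forall q, interval_total (F q) <= eps * (/ 2) ^ S q) ->
  interval_total (concat_upto p) <= eps * (1 - (/ 2) ^ S p).
Proof.
intros H. induction p as [|p IH].
- pose proof (H 0%nat). simpl in *. lra.
- pose proof (H (S p)). cbn [concat_upto]. rewrite interval_total_app.
  change (interval_total ((0, 0) :: F (S p))) with ((0 - 0) + interval_total (F (S p))).
  replace (eps * (1 - (/ 2) ^ S (S p)))
    with (eps * (1 - (/ 2) ^ S p) + eps * (/ 2) ^ S (S p)) by (simpl; field).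
  lra.
Qed.
End Concat.

(** Countable subadditivity: the p-th piece is covered with total length eps / 2^(p + 1), and the
    finite lists are strung together into the single sequence that [null_set] asks for. *)
Theorem null_set_of_covers (P : R -> Prop) (B : nat -> R -> Prop) :
  (forall y, P y -> exists p, B p y) ->
  (forall p eps, 0 < eps -> exists l : list (R * R),
     (forall I, In I l -> fst I <= snd I) /\ interval_total l <= eps /\
     (forall y, B p y -> exists I, In I l /\ fst I < y < snd I)) ->
  null_set P.
Proof.
intros HP HB eps Heps.
destruct (functional_choice (fun p l =>
     (forall I, In I l -> fst I <= snd I) /\ interval_total l <= eps * (/ 2) ^ S p /\
     (forall y, B p y -> exists I, In I l /\ fst I < y < snd I))) as [F HF].
{ intros p. apply HB. apply Rmult_lt_0_compat; [exact Heps|]. apply pow_lt. lra. }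
assert (HF1 : forall q I, In I (F q) -> fst I <= snd I) by (intros q; apply (HF q)).
set (e := fun k => nth k (concat_upto F k) (0, 0)).
exists (fun k => fst (e k)), (fun k => snd (e k)). repeat split.
- intros k. apply nth_In_fst_le_snd. intros I. now apply concat_upto_fst_le_snd.
- intros n.
  rewrite (sum_eq _ (fun k => snd (nth k (concat_upto F n) (0, 0)) -
                              fst (nth k (concat_upto F n) (0, 0)))).
  + eapply Rle_trans.
    { apply sum_nth_le_interval_total. intros I. now apply concat_upto_fst_le_snd. }
    eapply Rle_trans.
    { apply (interval_total_concat_upto F eps n). intros q. apply (HF q). }
    assert (0 < (/ 2) ^ S n) by (apply pow_lt; lra). nra.
  + intros k Hk. unfold e. now rewrite (nth_concat_upto F k n Hk).
- intros y Hy. destruct (HP y Hy) as [p Hp].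
  destruct (HF p) as [_ [_ Hc]]. destruct (Hc y Hp) as [I [HI Hy']].
  apply In_concat_upto in HI.
  destruct (In_nth _ _ (0, 0) HI) as [k [Hk E]].
  (* The interval has position k in the p-th concatenation, whereas [e k] is read in the k-th one.
     One of the two is a prefix of the other, so the entries agree. *)
  destruct (Nat.le_gt_cases k p) as [Hkp|Hkp].
  + exists k. unfold e. rewrite <- (nth_concat_upto F k p Hkp), E. exact Hy'.
  + exists k. unfold e.
    assert (Ek : forall q, (p <= q)%nat -> nth k (concat_upto F q) (0, 0) = I).
    { induction 1 as [|q Hq IH]; [exact E|]. simpl. rewrite app_nth1; [exact IH|].
      clear - Hq Hk. induction Hq as [|q Hq IH]; [exact Hk|]. simpl.
      rewrite length_app. lia. }
    rewrite Ek by lia. exact Hy'.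
Qed.

(** * Comparison with real powers *)

Lemma pow_lt_pow a b s : 0 <= a < b -> (0 < s)%nat -> a ^ s < b ^ s.
Proof.
intros Hab Hs. induction s as [|s IH]; [lia|]. destruct s as [|s]; [simpl; lra|].
specialize (IH ltac:(lia)).
assert (0 <= a ^ S s) by (apply pow_le; lra).
change (a * a ^ S s < b * b ^ S s). nra.
Qed.

Lemma pow_le_cancel a b s : 0 <= a -> 0 <= b -> (0 < s)%nat -> a ^ s <= b ^ s -> a <= b.
Proof.
intros Ha Hb Hs H. destruct (Rle_lt_dec a b) as [|Hlt]; [assumption|].
pose proof (pow_lt_pow b a s ltac:(lra) Hs). lra.
Qed.

(** Reduces a bound by x^e to one between natural powers, through c <= x^(k/s) and k / s <= e. *)
Lemma le_Rpower c x e (s k : nat) : 0 <= c -> 1 <= x -> (0 < s)%nat ->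
  INR k <= e * INR s -> c ^ s <= x ^ k -> c <= Rpower x e.
Proof.
intros Hc Hx Hs Hk Hcs.
assert (Hp : 0 < Rpower x e) by apply exp_pos.
apply pow_le_cancel with s; [lra | lra | lia |].
rewrite <- (Rpower_pow s (Rpower x e)), Rpower_mult by lra.
eapply Rle_trans; [exact Hcs|]. rewrite <- Rpower_pow by lra.
apply Rle_Rpower; lra.
Qed.

(** * The covering argument *)

(** A Lipschitz substitute for the indicator of u >= V, rising linearly from V / 2 to V. *)
Definition level (V u : R) : R := Rmax 0 (Rmin 1 (2 * u / V - 1)).

Lemma level_bounds V u : 0 <= level V u <= 1.
Proof.
unfold level. split; [apply Rmax_l|]. apply Rmax_lub; [lra|apply Rmin_l].
Qed.

Lemma level_eq1 V u : 0 < V <= u -> level V u = 1.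
Proof.
intros H. unfold level. assert (2 <= 2 * u / V).
{ apply Rmult_le_reg_r with V; [lra|]. unfold Rdiv. rewrite Rmult_assoc, Rinv_l; lra. }
rewrite Rmin_left by lra. apply Rmax_right; lra.
Qed.

Lemma level_eq0 V u : 0 < V -> u <= V / 2 -> level V u = 0.
Proof.
intros HV H. unfold level. assert (2 * u / V <= 1).
{ apply Rmult_le_reg_r with V; [lra|]. unfold Rdiv. rewrite Rmult_assoc, Rinv_l; lra. }
rewrite Rmin_right by lra. apply Rmax_left; lra.
Qed.

Lemma level_lipschitz V u v : 1 <= V -> Rabs (level V u - level V v) <= 2 * Rabs (u - v).
Proof.
intros HV.
assert (H : forall s t, Rabs (Rmax 0 (Rmin 1 s) - Rmax 0 (Rmin 1 t)) <= Rabs (s - t)).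
{ intros s t. unfold Rmax, Rmin.
  repeat (destruct (Rle_dec _ _)); unfold Rabs; repeat destruct (Rcase_abs _); lra. }
eapply Rle_trans; [apply H|].
replace (2 * u / V - 1 - (2 * v / V - 1)) with (/ V * (2 * (u - v))) by (field; lra).
rewrite !Rabs_mult, (Rabs_pos_eq 2) by lra.
assert (0 < / V) by (apply Rinv_0_lt_compat; lra).
assert (/ V <= 1) by (rewrite <- Rinv_1; apply Rinv_le_contravar; lra).
rewrite (Rabs_pos_eq (/ V)) by lra. pose proof (Rabs_pos (u - v)). nra.
Qed.

(** Dyadic layer-cake: the levels 1, 2, ..., 2^i not exceeding u add up to 2^(i+1) - 1. The index is
    [pred j] because [ssum] starts at 1. *)
Lemma ssum_level_ge u J :
  Rmin u (2 ^ J) - 1 <= ssum (fun j => 2 ^ pred j * level (2 ^ pred j) u) J.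
Proof.
induction J as [|J IH]; cbn [ssum pred].
- pose proof (Rmin_r u (2 ^ 0)). simpl in *. lra.
- assert (H2 : 0 < 2 ^ J) by (apply pow_lt; lra).
  destruct (Rle_lt_dec (2 ^ J) u) as [H|H].
  + rewrite level_eq1 by lra. rewrite Rmin_right in IH by lra.
    pose proof (Rmin_r u (2 ^ S J)). change (2 ^ S J) with (2 * 2 ^ J) in *. lra.
  + rewrite Rmin_left in IH by lra. pose proof (Rmin_l u (2 ^ S J)).
    pose proof (level_bounds (2 ^ J) u). nra.
Qed.

Lemma ssum_exchange (F : nat -> nat -> R) m n :
  ssum (fun i => ssum (fun j => F i j) n) m = ssum (fun j => ssum (fun i => F i j) m) n.
Proof.
induction m as [|m IH]; simpl.
- rewrite ssum_const. ring.
- rewrite IH, ssum_plus. reflexivity.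
Qed.

Lemma ssum_pigeonhole f n c : (0 < n)%nat -> c <= ssum f n ->
  exists j, (1 <= j <= n)%nat /\ c / INR n <= f j.
Proof.
intros Hn Hc. apply NNPP. intros Hno.
assert (HnR : 0 < INR n) by (apply lt_0_INR; lia).
assert (Hlt : forall k, (0 < k <= n)%nat -> ssum f k < INR k * (c / INR n)).
{ induction k as [|k IH]; intros Hk; [lia|].
  assert (f (S k) < c / INR n).
  { apply Rnot_le_lt. intros H. apply Hno. exists (S k). split; [lia|exact H]. }
  rewrite S_INR. destruct k as [|k]; [simpl; lra|].
  specialize (IH ltac:(lia)). change (ssum f (S k) + f (S (S k)) < (INR (S k) + 1) * (c / INR n)).
  lra. }
specialize (Hlt n ltac:(lia)).
replace (INR n * (c / INR n)) with c in Hlt by (field; lra). lra.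
Qed.

(** Average the layer-cake bound over the grid, exchange the sums, and pick the best of the J
    levels. *)
Lemma exists_dyadic_level (u : nat -> R) Q J c : (0 < Q)%nat -> (0 < J)%nat ->
  (forall x, u x < 2 ^ J) -> c <= ssum u Q / INR Q ->
  exists j, (j < J)%nat /\
    (c - 1) / INR J <= 2 ^ j * (ssum (fun x => level (2 ^ j) (u x)) Q / INR Q).
Proof.
intros HQ HJ Hu Hc.
assert (HQR : 0 < INR Q) by (apply lt_0_INR; lia).
destruct (ssum_pigeonhole
  (fun j => 2 ^ pred j * (ssum (fun x => level (2 ^ pred j) (u x)) Q / INR Q)) J (c - 1) HJ)
  as [j [Hj H]].
- rewrite (ssum_ext _ (fun j => / INR Q *
     ssum (fun x => 2 ^ pred j * level (2 ^ pred j) (u x)) Q)).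
  2:{ intros j _. rewrite ssum_scal. field. lra. }
  rewrite ssum_scal, <- ssum_exchange.
  assert (H1 : ssum (fun x => u x + -1) Q <=
    ssum (fun x => ssum (fun j => 2 ^ pred j * level (2 ^ pred j) (u x)) J) Q).
  { apply ssum_le. intros x _. pose proof (ssum_level_ge (u x) J).
    rewrite Rmin_left in H by (pose proof (Hu x); lra). lra. }
  rewrite ssum_plus, ssum_const in H1.
  apply Rmult_le_compat_l with (r := / INR Q) in H1; [|left; now apply Rinv_0_lt_compat].
  replace (/ INR Q * (ssum u Q + INR Q * -1)) with (ssum u Q / INR Q - 1) in H1 by (field; lra).
  lra.
- exists (pred j). split; [lia|exact H].
Qed.

Lemma exists_nat_ceil z : 0 <= z -> exists H : nat, z <= INR H <= z + 1.
Proof.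
intros Hz. destruct (archimed z) as [H1 H2].
assert (0 <= up z)%Z by (apply le_IZR; lra).
exists (Z.to_nat (up z)). rewrite INR_IZR_INZ, Z2Nat.id by assumption. lra.
Qed.

Lemma exists_nat_floor z : 0 <= z -> exists r : nat, INR r <= z < INR r + 1.
Proof.
intros Hz. destruct (base_Int_part z) as [H1 H2].
assert (0 <= Int_part z)%Z.
{ assert (-1 < Int_part z)%Z by (apply lt_IZR; lra). lia. }
exists (Z.to_nat (Int_part z)). rewrite INR_IZR_INZ, Z2Nat.id by assumption. lra.
Qed.

Lemma exists_cutoff Q H : (0 < H)%nat -> 4 * INR H <= INR Q ->
  exists K : nat, (0 < K)%nat /\ (2 * H * K < Q)%nat /\ INR Q <= 4 * INR H * INR K.
Proof.
intros HH HQ.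
assert (HQ' : (4 * H <= Q)%nat) by (apply INR_le; rewrite mult_INR; simpl; lra).
(* The largest K with 2HK < Q. Then Q <= 2H(K + 1) <= 4HK. *)
exists ((Q - 1) / (2 * H))%nat.
pose proof (Nat.div_mod_eq (Q - 1) (2 * H)) as E.
pose proof (Nat.mod_upper_bound (Q - 1) (2 * H) ltac:(lia)) as M.
set (K := ((Q - 1) / (2 * H))%nat) in *.
assert (HK : (0 < K)%nat) by (destruct K; lia).
repeat split; [exact HK | lia |].
replace (4 * INR H * INR K) with (INR (4 * H * K)) by (rewrite !mult_INR; simpl; ring).
apply le_INR. nia.
Qed.

(* The arithmetic of Chebyshev's inequality: the main term of the variance is
   beaten by w = Hm >= y^2, the tail by the size of q. *)
Lemma chebyshev_count len q r y w H m Lam n K lam :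
  0 < q -> 4 <= y -> y <= n -> 0 <= r <= y -> 0 < m -> 1 <= m * n ^ 2 -> 0 < H ->
  w = H * m -> y ^ 2 <= w -> H <= 2 * n ^ 4 -> 0 <= Lam -> 0 < K -> q <= 4 * H * K ->
  lam = 2 * Lam / q -> 512 * Lam ^ 2 * n ^ 13 <= q ->
  len * w ^ 2 <= 2 * (q * (r * w)) + 2 * (q * (H ^ 2 * (q * (lam / (K / q)) ^ 2))) ->
  len <= 3 * q / y.
Proof.
intros Hq Hy Hyn Hr Hm Hmn HH Hw Hyw HHn HLam HK HqK -> HqL Hlen.
assert (Hn : 0 < n) by lra.
assert (Hw0 : 0 < w) by nra.
assert (Hqw : 0 < q * w) by now apply Rmult_lt_0_compat.
assert (HQK : 2 * Lam / q / (K / q) <= 8 * Lam * H / q).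
{ replace (2 * Lam / q / (K / q)) with (2 * Lam * / K) by (field; lra).
  replace (8 * Lam * H / q) with (2 * Lam * (4 * H / q)) by (field; lra).
  apply Rmult_le_compat_l; [lra|].
  apply Rmult_le_reg_r with (K * q); [nra|].
  replace (/ K * (K * q)) with q by (field; lra).
  replace (4 * H / q * (K * q)) with (4 * H * K) by (field; lra). exact HqK. }
assert (HQK0 : 0 <= 2 * Lam / q / (K / q)).
{ unfold Rdiv. repeat apply Rmult_le_pos; try lra; left; repeat apply Rinv_0_lt_compat; try lra.
  apply Rmult_lt_0_compat; [lra|now apply Rinv_0_lt_compat]. }
(* The left side is at most 128 Lam^2 H^4. One factor H^2 goes into w^2, the other is at most 4 n^8,
   and 1 <= (m n^2)^2 brings in m^2 at the cost of n^4. One more n, from y <= n, gives 512 Lam^2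
   n^13. *)
assert (Htail : 2 * (q * (H ^ 2 * (q * (2 * Lam / q / (K / q)) ^ 2))) <= w ^ 2 * (q / y)).
{ apply Rle_trans with (2 * (q * (H ^ 2 * (q * (8 * Lam * H / q) ^ 2)))).
  - apply Rmult_le_compat_l; [lra|]. apply Rmult_le_compat_l; [lra|].
    apply Rmult_le_compat_l; [apply pow2_ge_0|]. apply Rmult_le_compat_l; [lra|].
    now apply pow_incr.
  - replace (2 * (q * (H ^ 2 * (q * (8 * Lam * H / q) ^ 2))))
      with (H ^ 2 * (128 * (Lam ^ 2 * H ^ 2))) by (field; lra).
    rewrite Hw. replace ((H * m) ^ 2 * (q / y)) with (H ^ 2 * (m ^ 2 * (q / y))) by ring.
    apply Rmult_le_compat_l; [apply pow2_ge_0|].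
    apply Rle_trans with (m ^ 2 * (q / n)).
    + apply Rle_trans with (512 * Lam ^ 2 * n ^ 8).
      * assert (H ^ 2 <= (2 * n ^ 4) ^ 2) by (apply pow_incr; lra).
        pose proof (pow2_ge_0 Lam).
        replace (512 * Lam ^ 2 * n ^ 8) with (128 * (Lam ^ 2 * (2 * n ^ 4) ^ 2)) by ring.
        apply Rmult_le_compat_l; [lra|]. now apply Rmult_le_compat_l.
      * assert (Hq' : 512 * Lam ^ 2 * n ^ 12 <= q / n).
        { apply Rmult_le_reg_r with n; [lra|]. replace (q / n * n) with q by (field; lra).
          replace (512 * Lam ^ 2 * n ^ 12 * n) with (512 * Lam ^ 2 * n ^ 13) by ring. exact HqL. }
        assert (Hm2 : 1 <= (m * n ^ 2) ^ 2) by (rewrite <- (pow1 2); apply pow_incr; lra).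
        pose proof (pow2_ge_0 Lam).
        assert (0 <= n ^ 8) by (apply pow_le; lra).
        apply Rle_trans with (m ^ 2 * (512 * Lam ^ 2 * n ^ 12)).
        -- replace (m ^ 2 * (512 * Lam ^ 2 * n ^ 12))
             with (512 * Lam ^ 2 * n ^ 8 * (m * n ^ 2) ^ 2) by ring.
           assert (0 <= 512 * Lam ^ 2 * n ^ 8) by (apply Rmult_le_pos; lra).
           nra.
        -- apply Rmult_le_compat_l; [apply pow2_ge_0|exact Hq'].
    + apply Rmult_le_compat_l; [apply pow2_ge_0|]. unfold Rdiv.
      apply Rmult_le_compat_l; [lra|]. apply Rinv_le_contravar; lra. }
(* Here r <= y and y <= w / y. *)
assert (Hmain : 2 * (q * (r * w)) <= w ^ 2 * (2 * q / y)).
{ apply Rle_trans with (2 * q * w * y).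
  { replace (2 * (q * (r * w))) with (2 * (q * w) * r) by ring. nra. }
  replace (w ^ 2 * (2 * q / y)) with (2 * q * w * (w / y)) by (field; lra).
  apply Rmult_le_compat_l; [lra|].
  apply Rmult_le_reg_r with y; [lra|]. replace (w / y * y) with w by (field; lra). nra. }
assert (0 < w ^ 2) by (apply pow_lt; lra).
apply Rmult_le_reg_l with (w ^ 2); [lra|].
replace (w ^ 2 * (3 * q / y)) with (w ^ 2 * (2 * q / y) + w ^ 2 * (q / y)) by (field; lra).
lra.
Qed.

Lemma exp_sum_abs_grid_period a N Q y : (0 < Q)%nat ->
  exp_sum_abs a N (INR (y + Q) / INR Q) = exp_sum_abs a N (INR y / INR Q).
Proof.
intros HQ. assert (0 < INR Q) by (apply lt_0_INR; lia).
apply exp_sum_abs_eq. intros n. exists (a n). rewrite plus_INR. field. lra.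
Qed.

(** Here y stands for N^e and U for N^(tau - e). The loss y^7 is made of y for the choice among J
    levels, y^2 for Hm, and y^4 to absorb the numerical constants. A grid point x is listed when G
    (h x) = 0 for all h <= H; small discrepancy at alpha forces this at the left end of the cell of
    alpha. *)
Theorem small_discrepancy_cover (a : nat -> Z) (N Q J r : nat) (A U y : R)
    (pr : Riemann_integrable (exp_sum_abs a N) 0 1) :
  (0 < Q)%nat -> 1 <= A -> (forall n, (1 <= n <= N)%nat -> Rabs (IZR (a n)) <= A) ->
  4 <= y <= INR N -> 4 <= U -> U < RiemannInt pr ->
  2 * INR N < 2 ^ J <= 4 * INR N -> INR J <= y -> INR r <= y ->
  (forall n, (0 < n)%nat -> (n <= Q)%nat -> (seq.size (prime.divisors n) <= r)%nat) ->
  512 * (4 * PI * INR N * A) ^ 2 * INR N ^ 13 <= INR Q ->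
  exists l : list nat, INR (length l) <= 3 * INR Q / y /\
    forall alpha, 0 <= alpha < 1 ->
      INR N * discrepancy (fun n => frac_part (IZR (a n) * alpha)) N <= U / y ^ 7 ->
      exists x, In x l /\ INR x / INR Q <= alpha < (INR x + 1) / INR Q.
Proof.
intros HQ HA1 HA Hy HU Hpr HJ HJy Hry Hdiv HQbig.
set (n := INR N) in *. set (q := INR Q) in *.
set (Lam := 4 * PI * n * A) in *.
set (f := exp_sum_abs a N) in *.
pose proof PI2_1 as HPI1. pose proof PI_4 as HPI4.
assert (Hq : 0 < q) by (apply lt_0_INR; lia).
assert (HLam : 1 <= Lam) by (unfold Lam; assert (1 <= PI * n) by nra; nra).
assert (Hlip : forall x z, f x <= f z + Lam * Rabs (x - z)).
{ intros x z. now apply exp_sum_abs_lipschitz. }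
(* With h <= H <= 2 n^4, replacing h alpha by its grid approximation will change f by at most 1 /
   4. *)
assert (HqLam : 8 * Lam * n ^ 4 <= q).
{ eapply Rle_trans; [|exact HQbig].
  assert (H4 : 0 <= n ^ 4) by (apply pow_le; lra).
  assert (H9 : 1 <= n ^ 9) by (apply pow_R1_Rle; lra).
  replace (512 * Lam ^ 2 * n ^ 13) with (8 * Lam * n ^ 4 * (64 * Lam * n ^ 9)) by ring.
  assert (1 <= 64 * Lam * n ^ 9) by nra.
  assert (0 <= 8 * Lam * n ^ 4) by (apply Rmult_le_pos; lra). nra. }
assert (Hn4 : 1 <= n ^ 4) by (apply pow_R1_Rle; lra).
assert (HJ0 : (0 < J)%nat) by (destruct J; [simpl in HJ; lra | lia]).
assert (HJR : 0 < INR J) by (apply lt_0_INR; lia).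
(* The 1 subtracted from U is the error of the Riemann sum. The layer-cake takes another 1, and U -
   2 >= U / 2. *)
destruct (exists_dyadic_level (fun x => f (INR x / q)) Q J (U - 1) HQ HJ0) as [j [HjJ Hj]].
{ intros x. pose proof (exp_sum_abs_le a N (INR x / q)). fold f n in H. lra. }
{ pose proof (RiemannInt_le_ssum f Lam Q pr HQ Hlip) as H. fold q in H.
  assert (Lam / q <= 1).
  { apply Rmult_le_reg_r with q; [lra|]. replace (Lam / q * q) with Lam by (field; lra). nra. }
  fold q. lra. }
fold q in Hj. set (V := 2 ^ j) in *.
assert (HV : 1 <= V <= 2 * n).
{ split; [apply pow_R1_Rle; lra|]. unfold V.
  assert (2 ^ S j <= 2 ^ J) by (apply Rle_pow; [lra|lia]). simpl in H. lra. }
set (G := fun x => level V (f (INR x / q))).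
set (m := ssum G Q / q).
change (ssum (fun x => level V (f (INR x / q))) Q / q) with m in Hj.
assert (HVm : U / (2 * y) <= V * m).
{ eapply Rle_trans; [|exact Hj]. apply Rle_trans with (U / 2 / INR J).
  - replace (U / (2 * y)) with (U / 2 * / y) by (field; lra). unfold Rdiv at 2.
    apply Rmult_le_compat_l; [lra|]. apply Rinv_le_contravar; lra.
  - apply Rmult_le_compat_r; [left; now apply Rinv_0_lt_compat|]. lra. }
assert (HUy : 0 < U / (2 * y)) by (apply Rdiv_lt_0_compat; lra).
assert (Hm0 : 0 < m) by nra.
assert (Hm1 : m <= 1).
{ assert (H : ssum G Q <= ssum (fun _ => 1) Q) by (apply ssum_le; intros; apply level_bounds).
  rewrite ssum_const in H. fold q in H. unfold m.
  apply Rmult_le_reg_r with q; [lra|]. replace (ssum G Q / q * q) with (ssum G Q) by (field; lra).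
  lra. }
(* A crude lower bound for m, from V <= 2n, U >= 4 and y <= n; it keeps H polynomial in n. *)
assert (Hmn : 1 <= m * n ^ 2).
{ assert (H1 : 2 / n <= U / (2 * y)).
  { apply Rle_trans with (2 / y).
    - apply Rmult_le_compat_l; [lra|]. apply Rinv_le_contravar; lra.
    - replace (U / (2 * y)) with (U / 2 * / y) by (field; lra).
      apply Rmult_le_compat_r; [left; apply Rinv_0_lt_compat; lra|lra]. }
  assert (H2 : 2 / n <= 2 * n * m) by nra.
  apply Rmult_le_compat_r with (r := n / 2) in H2; [|lra].
  replace (2 / n * (n / 2)) with 1 in H2 by (field; lra). lra. }
assert (Hy2 : 16 <= y ^ 2) by nra.
(* Rounding up keeps Hm between y^2 and 2 y^2, since m <= 1. *)
destruct (exists_nat_ceil (y ^ 2 / m)) as [H HH].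
{ apply Rmult_le_pos; [nra|left; now apply Rinv_0_lt_compat]. }
assert (HHm : y ^ 2 <= INR H * m <= 2 * y ^ 2).
{ assert (E : y ^ 2 / m * m = y ^ 2) by (field; lra). split; nra. }
assert (HHR : 0 < INR H) by nra.
assert (HH0 : (0 < H)%nat) by (apply INR_lt; exact HHR).
assert (HHn : INR H <= 2 * n ^ 4).
{ assert (y ^ 2 <= n ^ 2) by (apply pow_incr; lra).
  assert (0 < n ^ 2) by nra.
  assert (INR H * 1 <= INR H * (m * n ^ 2)) by (apply Rmult_le_compat_l; lra).
  replace (2 * n ^ 4) with (2 * n ^ 2 * n ^ 2) by ring.
  nra. }
assert (HHV : INR H <= 4 * y ^ 3 * V / U).
{ apply Rmult_le_reg_r with (U / (2 * y)); [lra|].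
  replace (4 * y ^ 3 * V / U * (U / (2 * y))) with (V * (2 * y ^ 2)) by (field; lra).
  apply Rle_trans with (INR H * (V * m)); [apply Rmult_le_compat_l; lra|].
  replace (INR H * (V * m)) with (V * (INR H * m)) by ring.
  apply Rmult_le_compat_l; lra. }
destruct (exists_cutoff Q H HH0) as [K [HK0 [HKQ HqK]]].
{ fold q. nra. }
fold q in HqK.
assert (HKR : 0 < INR K) by (apply lt_0_INR; lia).
destruct (@Bridge.few_annihilated_points Q K H r G (2 * Lam / q) m) as [l [Hl Hlen]].
- exact HQ.
- exact HK0.
- intros x. unfold G, f, q. f_equal. now apply exp_sum_abs_grid_period.
- intros x. apply level_bounds.
- intros x. eapply Rle_trans; [apply level_lipschitz; lra|].
  unfold Rdiv. rewrite Rmult_assoc. apply Rmult_le_compat_l; [lra|].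
  assert (E : Rabs (INR (S x) * / q - INR x * / q) = / q).
  { rewrite S_INR. replace ((INR x + 1) * / q - INR x * / q) with (/ q) by ring.
    apply Rabs_pos_eq. left; now apply Rinv_0_lt_compat. }
  pose proof (Hlip (INR (S x) * / q) (INR x * / q)).
  pose proof (Hlip (INR x * / q) (INR (S x) * / q)).
  rewrite (Rabs_minus_sym (INR x * / q)) in H1. rewrite E in *.
  apply Rabs_le. lra.
- exact HKQ.
- intros k Hk HkK. apply Hdiv; [exact Hk|]. nia.
- reflexivity.
- exists l. split.
  { apply (chebyshev_count (INR (length l)) q (INR r) y (INR H * m) (INR H) m Lam n
      (INR K) (2 * Lam / q)); try assumption; try reflexivity; try lra.
    split; [apply pos_INR|lra]. }
  intros alpha Ha Hdisc.
  destruct (exists_nat_floor (q * alpha)) as [x Hx]; [nra|].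
  assert (HxQ : (x < Q)%nat) by (apply INR_lt; fold q; nra).
  assert (Hxa : INR x / q <= alpha < (INR x + 1) / q).
  { split.
    - apply Rmult_le_reg_r with q; [lra|]. replace (INR x / q * q) with (INR x) by (field; lra). lra.
    - apply Rmult_lt_reg_r with q; [lra|].
      replace ((INR x + 1) / q * q) with (INR x + 1) by (field; lra). lra. }
  exists x. split; [|exact Hxa].
  apply Hl; [exact HxQ|]. intros h Hh1 HhH.
  assert (HhR : 0 < INR h) by (apply lt_0_INR; lia).
  assert (HhHR : INR h <= INR H) by (apply le_INR; lia).
  unfold G. apply level_eq0; [lra|].
  assert (HN : (0 < N)%nat) by (apply INR_lt; fold n; simpl; lra).
  pose proof (exp_sum_abs_le_discrepancy a N h alpha HN ltac:(lia)) as HS. fold f n in HS.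
  pose proof (Hlip (INR (h * x) / q) (INR h * alpha)) as HL.
  assert (E : Rabs (INR (h * x) / q - INR h * alpha) <= INR H / q).
  { rewrite mult_INR. replace (INR h * INR x / q - INR h * alpha)
      with (- (INR h * (alpha - INR x / q))) by (field; lra).
    rewrite Rabs_Ropp, Rabs_pos_eq by (apply Rmult_le_pos; lra).
    replace ((INR x + 1) / q) with (INR x / q + / q) in Hxa by (field; lra).
    unfold Rdiv at 2. apply Rmult_le_compat; lra. }
  assert (H1 : Lam * Rabs (INR (h * x) / q - INR h * alpha) <= V / 4).
  { apply Rle_trans with (Lam * (INR H / q)); [apply Rmult_le_compat_l; lra|].
    apply Rmult_le_reg_r with q; [lra|].
    replace (Lam * (INR H / q) * q) with (Lam * INR H) by (field; lra).
    assert (Lam * INR H <= Lam * (2 * n ^ 4)) by (apply Rmult_le_compat_l; lra). nra. }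
  (* Koksma, PI <= 4 and the bound on H give 32 V / y^4, and y >= 4. The other V / 4 is the grid
     error, so f (h x / Q) <= V / 2, where the cut-off vanishes. *)
  assert (H2 : f (INR h * alpha) <= V / 4).
  { eapply Rle_trans; [exact HS|].
    assert (Hy7 : 0 < U / y ^ 7) by (apply Rdiv_lt_0_compat; [lra|apply pow_lt; lra]).
    apply Rle_trans with (8 * (4 * y ^ 3 * V / U) * (U / y ^ 7)).
    - apply Rle_trans with (8 * INR H * (U / y ^ 7)).
      + apply Rle_trans with (2 * PI * INR h * (U / y ^ 7)).
        * apply Rmult_le_compat_l; [nra|exact Hdisc].
        * apply Rmult_le_compat_r; [lra|]. nra.
      + apply Rmult_le_compat_r; lra.
    - replace (8 * (4 * y ^ 3 * V / U) * (U / y ^ 7)) with (32 * V / y ^ 4) by (field; lra).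
      assert (Hy4 : 256 <= y ^ 4) by (replace 256 with (4 ^ 4) by ring; apply pow_incr; lra).
      apply Rmult_le_reg_r with (y ^ 4); [lra|].
      replace (32 * V / y ^ 4 * y ^ 4) with (32 * V) by (field; lra). nra. }
  lra.
Qed.

(** * Choice of the parameters and conclusion *)

Lemma le_subseq (BL : nat -> nat) :
  (forall L, (1 <= L)%nat -> (0 < BL L)%nat) ->
  (forall L, (1 <= L)%nat -> (BL L < BL (S L))%nat) ->
  forall L, (1 <= L)%nat -> (L <= BL L)%nat.
Proof.
intros H1 H2 L HL. induction HL as [|L HL IH]; [apply (H1 1%nat); lia|].
pose proof (H2 L HL). lia.
Qed.

(** The terms before n0 are bounded by the sum C of their absolute values, and C <= N is paid for by
    one more power of N. *)
Lemma poly_growth_uniform (a : nat -> Z) t n0 :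
  (forall n, (n0 <= n)%nat -> Rabs (IZR (a n)) <= INR n ^ t) ->
  exists C, 0 <= C /\ forall N, C <= INR N -> forall n, (1 <= n <= N)%nat ->
    Rabs (IZR (a n)) <= INR N ^ S t.
Proof.
intros H. exists (ssum (fun n => Rabs (IZR (a n))) n0).
assert (Hpos : forall k, 0 <= ssum (fun n => Rabs (IZR (a n))) k).
{ induction k as [|k IH]; simpl; [lra|]. pose proof (Rabs_pos (IZR (a (S k)))). lra. }
split; [apply Hpos|]. intros N HN n Hn.
assert (HN1 : 1 <= INR N) by (apply (le_INR 1); lia).
assert (HNt : 1 <= INR N ^ t) by (now apply pow_R1_Rle).
destruct (Nat.le_gt_cases n0 n) as [Hn0|Hn0].
- eapply Rle_trans; [apply H; exact Hn0|].
  assert (INR n ^ t <= INR N ^ t).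
  { apply pow_incr. split; [apply pos_INR|apply le_INR; lia]. }
  simpl. nra.
- assert (Hle : forall k, (n <= k)%nat ->
    Rabs (IZR (a n)) <= ssum (fun n => Rabs (IZR (a n))) k).
  { induction 1 as [|k Hk IH].
    - destruct n as [|n]; [lia|]. simpl. pose proof (Hpos n). lra.
    - simpl. pose proof (Rabs_pos (IZR (a (S k)))). lra. }
  specialize (Hle n0 ltac:(lia)). simpl. nra.
Qed.

Lemma interval_total_cells q (l : list nat) : 0 < q ->
  interval_total (map (fun x => ((INR x - 1) / q, (INR x + 1) / q)) l) =
  INR (length l) * (2 / q).
Proof.
intros Hq. induction l as [|x l IH]; [simpl; ring|].
cbn [map interval_total fold_right length fst snd]. rewrite S_INR.
unfold interval_total in IH. rewrite IH. field. lra.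
Qed.

(** An alpha that fails for every N > M fails for one N = B_L chosen in advance, as large as eta
    requires; the cover for this N has total length at most 6 / y = 6 N^(-e). *)
Lemma exceptional_set_cover (a : nat -> Z) (tau : R) (BL : nat -> nat) :
  (exists (t n0 : nat), forall n, (n0 <= n)%nat -> Rabs (IZR (a n)) <= INR n ^ t) ->
  0 < tau < 1 ->
  (forall L, (1 <= L)%nat -> (L <= BL L)%nat) ->
  (forall eps, 0 < eps -> exists L0 : nat, forall L, (L0 < L)%nat ->
     exists pr : Riemann_integrable (exp_sum_abs a (BL L)) 0 1,
       RiemannInt pr > Rpower (INR (BL L)) (tau - eps)) ->
  forall eps (M : nat) eta, 0 < eps <= tau -> 0 < eta ->
  exists l : list (R * R),
    (forall I, In I l -> fst I <= snd I) /\ interval_total l <= eta /\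
    (forall alpha, 0 <= alpha < 1 ->
       (forall N, (M < N)%nat ->
          INR N * discrepancy (fun n => frac_part (IZR (a n) * alpha)) N
            <= Rpower (INR N) (tau - eps)) ->
       exists I, In I l /\ fst I < alpha < snd I).
Proof.
intros [t [n0 Hgrow]] Htau HBL Hint eps M eta Heps Heta.
destruct (poly_growth_uniform a t n0 Hgrow) as [C0 [HC0 Hpoly]].
(* U / y^7 = N^(tau - 8e) fixes e. With A = N^T, the grid must be finer than a constant times N^(2T
   + 2 + 13); the last power of N beats the constant. *)
set (e := eps / 8). set (T := S t). set (W := (2 * T + 16)%nat).
assert (He : 0 < e) by (unfold e; lra).
destruct (exists_nat_ceil (INR (W + 2) / e)) as [s Hs].
{ apply Rmult_le_pos; [apply pos_INR|left; now apply Rinv_0_lt_compat]. }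
assert (Hes : INR (W + 2) <= e * INR s).
{ replace (INR (W + 2)) with (e * (INR (W + 2) / e)) by (field; lra).
  apply Rmult_le_compat_l; lra. }
assert (Hes' : forall k, (k <= W + 2)%nat -> INR k <= e * INR s).
{ intros k Hk. apply le_INR in Hk. lra. }
assert (Hs0 : (0 < s)%nat).
{ apply INR_lt. simpl. pose proof (lt_0_INR (W + 2) ltac:(lia)). nra. }
destruct (Bridge.divisor_bound_R Hs0) as [C HC].
destruct (Hint e He) as [L0 HL0].
assert (P1 : 0 <= INR C) by apply pos_INR.
assert (P2 : 0 <= 4 * INR s ^ s) by (pose proof (pow_le (INR s) s (pos_INR s)); lra).
assert (P3 : 0 <= 4 ^ s) by (apply pow_le; lra).
assert (P4' : 0 <= 6 / eta) by (left; apply Rdiv_lt_0_compat; lra).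
assert (P4 : 0 <= (6 / eta) ^ s) by (now apply pow_le).
(* One summand per largeness condition on N: initial terms of the sequence, 131072 = 8192 * 4^2 for
   8192 PI^2, the divisor bound, J <= y, the bounds 4 <= y and 4 <= U, and 6 / eta <= y. *)
destruct (exists_nat_ceil (C0 + 131072 + INR C + 4 * INR s ^ s + 4 ^ s + (6 / eta) ^ s))
  as [L1 HL1]; [lra|].
set (L := (S L0 + S M + L1)%nat).
destruct (HL0 L ltac:(unfold L; lia)) as [pr Hpr].
pose proof (HBL L ltac:(unfold L; lia)) as HLN.
set (N := BL L) in *.
assert (HMN : (M < N)%nat) by (unfold L in HLN; lia).
assert (HnL : INR L1 <= INR N) by (apply le_INR; unfold L in HLN; lia).
set (n := INR N) in *.
assert (Hn1 : 1 <= n) by lra.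
set (y := Rpower n e). set (U := Rpower n (tau - e)).
assert (Hy0 : 0 < y) by apply exp_pos.
assert (Hy4 : 4 <= y).
{ apply (le_Rpower 4 n e s 1 ltac:(lra) Hn1 Hs0); [apply Hes'; lia|]. rewrite pow_1. lra. }
assert (Hyeta : 6 / eta <= y).
{ apply (le_Rpower _ n e s 1 P4' Hn1 Hs0); [apply Hes'; lia|]. rewrite pow_1. lra. }
assert (Hyn : y <= n).
{ rewrite <- (Rpower_1 n) by lra. apply Rle_Rpower; unfold e; lra. }
assert (HU : 4 <= U).
{ apply (le_Rpower 4 n (tau - e) s 1 ltac:(lra) Hn1 Hs0).
  - pose proof (Hes' 1%nat ltac:(lia)). pose proof (pos_INR s).
    assert (e <= tau - e) by (unfold e; lra). nra.
  - rewrite pow_1. lra. }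
set (J := S (Nat.log2 (2 * N))).
assert (HJ : 2 * n < 2 ^ J <= 4 * n).
{ assert (HN : (0 < N)%nat) by lia.
  destruct (Nat.log2_spec (2 * N) ltac:(lia)) as [HJ1 HJ2]. fold J in HJ2.
  apply lt_INR in HJ2. apply le_INR in HJ1.
  rewrite pow_INR in HJ1, HJ2. rewrite mult_INR in HJ1, HJ2. simpl (INR 2) in HJ1, HJ2.
  change (1 + 1) with 2 in HJ1, HJ2. fold n in HJ1, HJ2.
  split; [exact HJ2|]. change (2 ^ J) with (2 * 2 ^ Nat.log2 (2 * N)). lra. }
assert (HJy : INR J <= y).
{ apply (le_Rpower _ n e s 2 (pos_INR J) Hn1 Hs0); [apply Hes'; lia|].
  eapply Rle_trans; [apply (Bridge.pow_le_pow2 J Hs0)|].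
  pose proof (pow_le (INR s) s (pos_INR s)). nra. }
set (Q := (N ^ W)%nat).
assert (HQE : INR Q = n ^ W) by apply pow_INR.
assert (HQ : (0 < Q)%nat).
{ apply INR_lt. rewrite HQE. apply pow_lt. lra. }
destruct (exists_nat_floor y) as [r Hr]; [lra|].
destruct (small_discrepancy_cover a N Q J r (n ^ T) U y pr) as [l [Hlen Hl]].
- exact HQ.
- now apply pow_R1_Rle.
- apply (Hpoly N). fold n. lra.
- fold n. lra.
- exact HU.
- exact Hpr.
- exact HJ.
- exact HJy.
- lra.
- intros k Hk HkQ.
  assert (Hd : INR (seq.size (prime.divisors k)) <= y).
  { apply (le_Rpower _ n e s (W + 1)%nat (pos_INR _) Hn1 Hs0); [apply Hes'; lia|].
    eapply Rle_trans; [apply HC; exact Hk|].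
    apply le_INR in HkQ. rewrite HQE in HkQ. rewrite pow_add, pow_1.
    pose proof (pos_INR k). rewrite Rmult_comm. apply Rmult_le_compat; lra. }
  assert (Hlt : INR (seq.size (prime.divisors k)) < INR (S r)) by (rewrite S_INR; lra).
  apply INR_lt in Hlt. lia.
- rewrite HQE. fold n. unfold W.
  replace (512 * (4 * PI * n * n ^ T) ^ 2 * n ^ 13)
    with (8192 * PI ^ 2 * (n ^ (2 * T) * n ^ 15))
    by (replace (2 * T)%nat with (T + T)%nat by lia; rewrite pow_add; ring).
  rewrite pow_add. replace (n ^ 16) with (n * n ^ 15) by ring.
  replace (n ^ (2 * T) * (n * n ^ 15)) with (n * (n ^ (2 * T) * n ^ 15)) by ring.
  apply Rmult_le_compat_r; [apply Rmult_le_pos; apply pow_le; lra|].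
  pose proof PI_4. pose proof PI_RGT_0. nra.
- assert (Hq : 0 < INR Q) by (apply lt_0_INR; lia).
  (* The cells are closed on the left and the covering intervals open, so each is extended one cell
     to the left. *)
  exists (map (fun x => ((INR x - 1) / INR Q, (INR x + 1) / INR Q)) l). repeat split.
  + intros I HI. apply in_map_iff in HI. destruct HI as [x [<- _]]. simpl.
    apply Rmult_le_compat_r; [left; now apply Rinv_0_lt_compat|lra].
  + rewrite interval_total_cells by exact Hq.
    apply Rle_trans with (6 / y).
    * replace (6 / y) with (3 * INR Q / y * (2 / INR Q)) by (field; lra).
      apply Rmult_le_compat_r; [left; apply Rdiv_lt_0_compat; lra|exact Hlen].
    * apply Rmult_le_reg_r with (y / eta); [apply Rdiv_lt_0_compat; lra|].
      replace (6 / y * (y / eta)) with (6 / eta) by (field; lra).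
      replace (eta * (y / eta)) with y by (field; lra). exact Hyeta.
  + intros alpha Ha Hd. destruct (Hl alpha Ha) as [x [Hx Hxa]].
    { eapply Rle_trans; [apply (Hd N HMN)|]. fold n. right.
      unfold U, y, Rdiv. rewrite <- Rpower_pow by apply exp_pos.
      rewrite Rpower_mult, <- Rpower_Ropp, <- Rpower_plus.
      f_equal. unfold e. simpl. field. }
    exists ((INR x - 1) / INR Q, (INR x + 1) / INR Q). split.
    * apply in_map_iff. now exists x.
    * simpl. split; [|lra].
      assert ((INR x - 1) / INR Q < INR x / INR Q); [|lra].
      apply Rmult_lt_compat_r; [now apply Rinv_0_lt_compat|lra].
Qed.

Theorem theorem3 (a : nat -> Z) (tau B' B : R) (BL : nat -> nat) :
  (exists (t n0 : nat), forall n, (n0 <= n)%nat -> Rabs (IZR (a n)) <= INR n ^ t) ->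
  0 < tau < 1 ->
  1 < B' -> B' < B ->
  (forall L, (1 <= L)%nat -> (0 < BL L)%nat) ->
  (forall L, (1 <= L)%nat -> (BL L < BL (S L))%nat) ->
  (forall L, (1 <= L)%nat -> B' ^ L <= INR (BL L) <= B ^ L) ->
  (forall eps, 0 < eps -> exists L0 : nat, forall L, (L0 < L)%nat ->
     exists pr : Riemann_integrable (exp_sum_abs a (BL L)) 0 1,
       RiemannInt pr > Rpower (INR (BL L)) (tau - eps)) ->
  null_set (fun alpha => 0 <= alpha < 1 /\
    ~ (forall eps, 0 < eps -> forall M : nat, exists N : nat, (M < N)%nat /\
         INR N * discrepancy (fun n => frac_part (IZR (a n) * alpha)) N
           > Rpower (INR N) (tau - eps))).
Proof.
intros Hgrow Htau _ _ Hpos Hincr _ Hint.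
pose proof (le_subseq BL Hpos Hincr) as HBL.
(* One index p serves both as the threshold M and, through eps = tau / (p + 1) <= tau, as the
   exponent. A failing pair (eps, M) is caught by p = P + M with P >= tau / eps. *)
apply (null_set_of_covers _ (fun p alpha => 0 <= alpha < 1 /\
  forall N, (p < N)%nat ->
    INR N * discrepancy (fun n => frac_part (IZR (a n) * alpha)) N
      <= Rpower (INR N) (tau - tau / (INR p + 1)))).
- intros alpha [Ha Hbad].
  apply not_all_ex_not in Hbad. destruct Hbad as [eps Hbad].
  apply imply_to_and in Hbad. destruct Hbad as [Heps Hbad].
  apply not_all_ex_not in Hbad. destruct Hbad as [M HM].
  destruct (exists_nat_ceil (tau / eps)) as [P HP].
  { left; apply Rdiv_lt_0_compat; lra. }
  exists (P + M)%nat. split; [exact Ha|]. intros N HN.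
  assert (HN1 : 1 <= INR N) by (apply (le_INR 1); lia).
  apply Rle_trans with (Rpower (INR N) (tau - eps)).
  + apply Rnot_lt_le. intros Hgt. apply HM. exists N. split; [lia|exact Hgt].
  + apply Rle_Rpower; [exact HN1|].
    assert (HPM : INR P <= INR (P + M)) by (apply le_INR; lia).
    pose proof (pos_INR P).
    assert (tau / (INR (P + M) + 1) <= eps); [|lra].
    apply Rmult_le_reg_r with (INR (P + M) + 1); [lra|].
    replace (tau / (INR (P + M) + 1) * (INR (P + M) + 1)) with tau by (field; lra).
    apply Rle_trans with (eps * (tau / eps)); [right; field; lra|].
    apply Rmult_le_compat_l; lra.
- intros p eta Heta. pose proof (pos_INR p).
  destruct (exceptional_set_cover a tau BL Hgrow Htau HBL Hint (tau / (INR p + 1)) p eta)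
    as [l [H1 [H2 H3]]].
  + split; [apply Rdiv_lt_0_compat; lra|].
    apply Rmult_le_reg_r with (INR p + 1); [lra|].
    replace (tau / (INR p + 1) * (INR p + 1)) with tau by (field; lra). nra.
  + exact Heta.
  + exists l. repeat split; [exact H1 | exact H2 |].
    intros alpha [Ha Hd]. now apply H3.
Qed.
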